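(* Let $k\geq 2$ be an integer and let $s$ be a $k$-automatic sequence. Then the sequences $(eL_s(n))_{n\in\mathbb{N}}$ and $(\Delta pL_s(n))_{n\in\mathbb{N}}$ are both $k$-automatic. Moreover, $(pL_s(n))_{n\in\mathbb{N}}$ is $k$-regular.
   Context: $\mathbb N=\{0,1,2,\dots\}$. A sequence $(s_n)_{n\in\mathbb N}$ over a finite alphabet is $k$-automatic if there is a finite automaton (with output) such that $s_n$ is its output on input the base-$k$ representation of $n$. A sequence $(t_n)_{n\in\mathbb N}$ with values in $\mathbb Z$ is $k$-regular if there are an integer row vector $v$, an integer column vector $z$, and a matrix-valued morphism $\zeta:\{0,\dots,k-1\}\to\mathbb Z^{d\times d}$ (extended multiplicatively to words) such that $t_n=v\,\zeta(x)\,z$, where $x$ is the base-$k$ representation of $n$. The sequence $s$ is regarded as the infinite word $w=s_0s_1s_2\cdots$, and $eL_s,pL_s,\Delta pL_s$ mean the functions $eL_w,pL_w,\Delta pL_w$ defined as follows. A factor of a finite or infinite word is a finite block of contiguous letters occurring in it (the empty word included); $\mathrm{Fac}(\cdot)$ is the set of factors. Finite words $u,v$ are conjugate if $u=xy$, $v=yx$ for some words $x,y$; $[u]$ is the conjugacy class of $u$. A finite word is primitive if it is not a power $v^j$ ($j$ a natural number) of another word (the empty word is not primitive); $\mathrm{Prim}(w)$ is the set of primitive factors of $w$. For a nonempty finite word $u$ and a positive integer $n$, $u^{n/|u|}$ is the length-$n$ prefix of $uuu\cdots$, and $[u]_n=\{v^{n/|v|}:v\in[u]\}$. Extended Lie complexity: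 for $n\ge1$, $eL_w(n)=|\{[p]_n : [p]_n\subset\mathrm{Fac}(w),\ n\ge|p|,\ p\in\mathrm{Prim}(w)\}|$ (number of distinct sets), and $eL_w(0)=1$. Prefix Lie complexity: letting $w_n$ be the length-$n$ prefix of $w$, $pL_w(n)=|\{[p] : [p]\subset\mathrm{Fac}(w_n)\}|$ (words $p$ of any length). Its first-order difference is $\Delta pL_w(n)=pL_w(n+1)-pL_w(n)$ for $n\in\mathbb N$. *)

(* Defs.v *)
From mathcomp Require Import all_boot all_order all_algebra.
From mathcomp Require Import finmap boolp classical_sets cardinality.

Set Implicit Arguments.
Unset Strict Implicit.
Unset Printing Implicit Defensive.

Local Open Scope classical_set_scope.

(* [base_rep n x]: x is the base-k representation of n, most significant digit
   first and without leading zeros; in particular 0 is represented by the empty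
   word. For k >= 2 there is exactly one such x, see [base_rep_unique_exists]. *)
Definition base_rep (k n : nat) (x : seq 'I_k) : Prop :=
  foldl (fun m (c : 'I_k) => m * k + c) 0 x = n /\
  (forall (c : 'I_k) y, x = c :: y -> (c : nat) <> 0).

(* The automaton has state type Q, initial state q0, transitions delta and
   output map tau. As Q is finite, s takes finitely many values even when the
   codomain T is infinite. *)
Definition automatic (k : nat) (T : Type) (s : nat -> T) : Prop :=
  exists (Q : finType) (q0 : Q) (delta : Q -> 'I_k -> Q) (tau : Q -> T),
    forall n x, base_rep n x -> s n = tau (foldl delta q0 x).

Definition regular (k : nat) (t : nat -> int) : Prop :=
  exists (d : nat) (v : 'rV[int]_d) (z : 'cV[int]_d) (zeta : 'I_k -> 'M[int]_d),
    forall n x, base_rep n x ->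
      t n = (v *m (\big[mulmx/1%:M]_(c <- x) zeta c) *m z)%R ord0 ord0.

Section Words.
Variable A : finType.
Implicit Types (u v p : seq A) (w : nat -> A).

Definition Fac w : set (seq A) :=
  [set u | exists i, u = mkseq (fun j => w (i + j)) (size u)].

Definition Fac_fin u : set (seq A) := [set v | infix v u].

Definition prefix_of w (n : nat) : seq A := mkseq w n.

Definition conj_class u : set (seq A) :=
  [set v | exists x y, u = x ++ y /\ v = y ++ x].

Definition word_pow v (j : nat) : seq A := flatten (nseq j v).

Definition primitive u : Prop :=
  u <> [::] /\ ~ exists v j, v <> u /\ u = word_pow v j.

Definition Prim w : set (seq A) := [set u | Fac w u /\ primitive u].

(* u^{n/|u|}: for nonempty u, n copies of u suffice to have length >= n. *)
Definition frac_pow u (n : nat) : seq A := take n (word_pow u n).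

(* [u]_n *)
Definition conj_class_at u (n : nat) : set (seq A) :=
  (fun v => frac_pow v n) @` conj_class u.

Definition eL_classes w (n : nat) : set (set (seq A)) :=
  [set C | exists p, [/\ C = conj_class_at p n, C `<=` Fac w,
                         size p <= n & Prim w p]].

Definition pL_classes w (n : nat) : set (set (seq A)) :=
  [set C | exists p, C = conj_class p /\ C `<=` Fac_fin (prefix_of w n)].

(* [fset_set] is the empty set on infinite sets; both families are finite by
   [finite_eL_classes] and [finite_pL_classes]. *)
Definition eL w (n : nat) : nat :=
  if n == 0 then 1 else #|` fset_set (eL_classes w n)|%fset.

Definition pL w (n : nat) : nat := #|` fset_set (pL_classes w n)|%fset.

Definition dpL w (n : nat) : int := ((pL w n.+1)%:Z - (pL w n)%:Z)%R.

Lemma finite_words_le n : finite_set [set u : seq A | size u <= n].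
Proof.
have fin : finite_set [set: {k : 'I_n.+1 & k.-tuple A}] by exact: finite_finset.
apply: sub_finite_set (finite_image
  (fun t : {k : 'I_n.+1 & k.-tuple A} => tval (tagged t)) fin) => u /= un.
rewrite -ltnS in un.
by exists (Tagged (fun k : 'I_n.+1 => k.-tuple A) (i := Ordinal un) (in_tuple u)).
Qed.

Lemma finite_subsets (F : set (seq A)) :
  finite_set F -> finite_set [set C : set (seq A) | C `<=` F].
Proof.
move=> finF.
have fin : finite_set [set: {set fset_set F}] by exact: finite_finset.
apply: sub_finite_set (finite_image (fun D : {set fset_set F} =>
  [set u | exists2 a, a \in D & u = val a]) fin) => C /= CF.
exists [set a : fset_set F | val a \in C]%SET => //.
apply/seteqP; split=> [u [a]|u Cu] /=.
  by rewrite inE => /set_mem aC ->.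
have uF : u \in fset_set F by rewrite in_fset_set //; apply/mem_set/CF.
by exists [` uF]%fset => //; rewrite inE; apply/mem_set.
Qed.

Lemma finite_eL_classes w n : finite_set (eL_classes w n).
Proof.
apply: sub_finite_set (finite_subsets (finite_words_le n)).
move=> C [p [-> _ _ _]] _ [v _ <-] /=.
by rewrite size_take_min geq_minl.
Qed.

Lemma finite_pL_classes w n : finite_set (pL_classes w n).
Proof.
apply: sub_finite_set (finite_subsets (finite_words_le n)).
move=> C [p [_ CF]] v /CF /= /size_infix.
by rewrite size_mkseq.
Qed.

End Words.

Lemma base_rep_unique_exists (k n : nat) :
  2 <= k -> exists! x : seq 'I_k, base_rep n x.
Proof.
move=> k2; have k0 : 0 < k by exact: ltnW.
have pos x : x <> [::] -> (forall (c : 'I_k) y, x = c :: y -> (c : nat) <> 0) ->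
    0 < foldl (fun m (c : 'I_k) => m * k + c) 0 x.
  case: x => // c y _ /(_ c y erefl) /eqP; rewrite -lt0n /= mul0n add0n.
  elim: y (nat_of_ord c) => //= d y IH m m0; apply: IH.
  by rewrite addn_gt0 muln_gt0 m0 k0.
suff [x [Hx Ux]] : exists x, base_rep n x /\ forall y : seq 'I_k,
    base_rep n y -> x = y by exists x.
elim/ltn_ind: n => n IH.
have [->|n0] := posnP n.
  exists [::]; split=> [|y [Ey Ly]]; first by split.
  case: y Ey Ly => // c y Ey Ly.
  have : 0 < 0 by rewrite -{2}Ey; apply: pos.
  by [].
have [x [[Ex Lx] Ux]] := IH (n %/ k) (ltn_Pdiv k2 n0).
pose c := Ordinal (ltn_pmod n k0).
exists (rcons x c); split.
  split; first by rewrite -cats1 foldl_cat /= Ex -divn_eq.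
  case: x Ex Lx {Ux} => [|a x] Ex Lx b y /= [<- _]; last exact: (Lx a x).
  by rewrite /= [n in n %% _](divn_eq n k) -Ex mul0n add0n modn_mod => m0;
    move: n0; rewrite (divn_eq n k) -Ex mul0n m0.
move=> y; case/lastP: y => [[/= E _]|y d [Ey Ly]]; first by rewrite -E in n0.
move: Ey; rewrite -cats1 foldl_cat /= => Ey.
have ed : d = c by apply: val_inj; rewrite /= -Ey modnMDl modn_small.
rewrite cats1 ed (Ux y) //; split.
  by rewrite -Ey divnMDl // divn_small // addn0.
by move=> a z E; apply: (Ly a (rcons z d)); rewrite E.
Qed.

(* Main.v *)
Require Import Defs.
From mathcomp Require Import all_boot all_order all_algebra.
From mathcomp Require Import finmap boolp classical_sets cardinality.
From mathcomp Require Import zify.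

(** Everything rests on first-order definability over the natural numbers with
addition and the sequence [s]. A function of finitely many natural numbers is
recognizable when reading off last digits produces only finitely many functions
([recog]); recognizable predicates are closed under connectives and quantifiers,
contain the graph of addition, and a recognizable function of one variable is
the same thing as a [k]-automatic sequence ([recog_automatic],
[automatic_recog]). So it suffices to describe both counts by formulas and to
show that they are bounded.

For the prefix Lie complexity, a class that is new in the prefix of length
[n.+1] is the class of a suffix [c u] of that prefix which did not occur before.
The rotation [u c] occurs too, hence [u] occurs in the prefix of length [n], so
no shorter suffix is new: at most one class appears at each step
([new_block_inj]). Thus [dpL s] is the characteristic sequence of a definable
set, and [pL s] is its summatory sequence. Summation commutes with the linear
recurrences along digits, so the latter is regular ([regular_sum]).

For the extended Lie complexity, the set [p]_n consists of the windows of length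
[n] of the periodic word with period [p]. It does not change when [p] is
replaced by its primitive root, so primitivity disappears and [eL s n] counts the
sets of windows of periodic words of period at most [n] all of whose windows
occur in [s] ([eL_classesE]). The inequality [c <= eL s n] is expressed by the
existence of [c] such words with pairwise different sets of windows, each word
being given by a factor of [s].

It remains to bound [eL s] ([windows_code]). Cut [s] into blocks whose length is
a power of [k] comparable to [n]. Two consecutive blocks are determined by a pair
of states, so every window of length [n] has an address in a finite set that does
not depend on [n], and windows with the same address agree up to a shift of at
most [n %/ 24] ([automatic_locate]). A periodic word is shown to be determined by
a bounded number of addresses, in three cases.
- If it has a very short period, one address is enough ([short_period_inj]).
- If it has no long factor with a short period, take five addresses at distance
  at least [n./2]. Two words with these addresses agree up to a shift around
  each of the five places; two different consecutive shifts would create a long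
  factor with a short period, so all shifts are equal and the words agree on a
  length [2 * n], hence everywhere ([no_run_inj]).
- Otherwise it has a long run of a short period [p], chosen minimal, that breaks
  somewhere. A break cannot be moved by a small shift, so the address of a window
  around the break determines this window exactly, including the place where the
  next run starts; a second window taken there is determined in the same way. If
  it shows the end of this run, the whole word is known. If not, two words with
  these addresses have runs whose lengths differ by less than [p], and that
  difference is a period of the run, against the minimality of [p]
  ([long_run_inj]). *)

Set Implicit Arguments.
Unset Strict Implicit.
Unset Printing Implicit Defensive.

Import GRing.Theory.
Local Open Scope classical_set_scope.

(** * Recognizable functions and definable predicates *)

Definition scons (T : Type) (x : T) (e : nat -> T) : nat -> T :=
  fun i => if i is j.+1 then e j else x.

(** The variables are the values [e i] of an environment; [F q] runs through the
finitely many functions obtained from [f] by prescribing last digits. Reading the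
least significant digits first makes numbers of different lengths harmless: no
padding convention is needed. *)
Definition recog (k : nat) (X : Type) (f : (nat -> nat) -> X) : Prop :=
  exists (Q : finType) (F : Q -> (nat -> nat) -> X)
         (step : (nat -> 'I_k) -> Q -> Q) (q0 : Q),
    (forall e, F q0 e = f e) /\
    (forall q e (r : nat -> 'I_k), F q (fun i => k * e i + r i) = F (step r q) e).

Notation definable k := (@recog k Prop).

Section Recognizable.
Variable k : nat.
Hypothesis hk : 2 <= k.
Notation E := (nat -> nat).

Lemma recog_ext X (f g : E -> X) : (forall e, f e = g e) ->
  recog k f -> recog k g.
Proof. by move=> /funext <-. Qed.

Lemma recog_comp X Y (h : X -> Y) (f : E -> X) :
  recog k f -> recog k (fun e => h (f e)).
Proof.
move=> [Q [F [step [q0 [F0 FS]]]]].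
exists Q, (fun q e => h (F q e)), step, q0.
by split=> [e|q e r]; rewrite ?F0 ?FS.
Qed.

Lemma recog_pair X Y (f : E -> X) (g : E -> Y) :
  recog k f -> recog k g -> recog k (fun e => (f e, g e)).
Proof.
move=> [Q [F [step [q0 [F0 FS]]]]] [Q' [F' [step' [q0' [F0' FS']]]]].
exists (Q * Q')%type, (fun q e => (F q.1 e, F' q.2 e)),
  (fun r q => (step r q.1, step' r q.2)), (q0, q0').
by split=> [e|q e r]; rewrite ?F0 ?F0' ?FS ?FS'.
Qed.

Lemma recog_comp2 X Y Z (h : X -> Y -> Z) (f : E -> X) (g : E -> Y) :
  recog k f -> recog k g -> recog k (fun e => h (f e) (g e)).
Proof.
by move=> rf rg; apply: (recog_comp (fun p => h p.1 p.2) (recog_pair rf rg)).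
Qed.

Lemma recog_cst X (x : X) : recog k (fun=> x).
Proof. by exists unit, (fun _ _ => x), (fun _ q => q), tt. Qed.

Lemma recog_seq (I X : Type) (f : I -> E -> X) (s : seq I) :
  (forall i, recog k (f i)) -> recog k (fun e => [seq f i e | i <- s]).
Proof.
move=> rf; elim: s => [|i s IH] /=; first exact: recog_cst.
exact: (recog_comp2 cons).
Qed.

Lemma recog_reindex X (f : E -> X) (v : nat -> nat) :
  recog k f -> recog k (fun e => f (fun i => e (v i))).
Proof.
move=> [Q [F [step [q0 [F0 FS]]]]].
exists Q, (fun q e => F q (fun i => e (v i))),
  (fun r => step (fun i => r (v i))), q0.
by split=> [e|q e r]; rewrite ?F0 // (FS q (fun i => e (v i)) (fun i => r (v i))).
Qed.

(** Subset construction: a witness [x] is guessed digit by digit, so that states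
become sets of states, closed under all choices for the last digit of [x]. *)
Lemma definable_ex (P : nat -> E -> Prop) :
  definable k (fun e => P (e 0) (fun i => e i.+1)) ->
  definable k (fun e => exists x, P x e).
Proof.
have k0 : 0 < k by exact: ltnW.
move=> [Q [F [step [q0 [F0 FS]]]]].
exists {set Q}, (fun (S : {set Q}) e => exists q x, q \in S /\ F q (scons x e)),
  (fun r (S : {set Q}) => [set step (scons d r) q | q in S, d in 'I_k]%SET), [set q0]%SET.
split=> [e|S e r]; apply/propext; split.
- by move=> [q [x [/set1P -> Fx]]]; exists x; rewrite F0 in Fx.
- by move=> [x Px]; exists q0, x; rewrite inE eqxx F0.
- move=> [q [x [qS Fx]]].
  exists (step (scons (Ordinal (ltn_pmod x k0)) r) q), (x %/ k); split.
    by apply/imset2P; exists q (Ordinal (ltn_pmod x k0)).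
  rewrite -FS; congr (F q _): Fx; apply/funext => -[|i] //=.
  by rewrite mulnC -divn_eq.
- move=> [_ [x [/imset2P[q d qS _ ->] Fx]]].
  exists q, (k * x + d); split=> //.
  by rewrite -FS in Fx; congr (F q _): Fx; apply/funext => -[|i].
Qed.

Lemma definable_and (P Q : E -> Prop) :
  definable k P -> definable k Q -> definable k (fun e => P e /\ Q e).
Proof. exact: recog_comp2. Qed.

Lemma definable_or (P Q : E -> Prop) :
  definable k P -> definable k Q -> definable k (fun e => P e \/ Q e).
Proof. exact: recog_comp2. Qed.

Lemma definable_imp (P Q : E -> Prop) :
  definable k P -> definable k Q -> definable k (fun e => P e -> Q e).
Proof. exact: (recog_comp2 (fun P Q : Prop => P -> Q)). Qed.

Lemma definable_iff (P Q : E -> Prop) :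
  definable k P -> definable k Q -> definable k (fun e => P e <-> Q e).
Proof. exact: recog_comp2. Qed.

Lemma definable_not (P : E -> Prop) : definable k P -> definable k (fun e => ~ P e).
Proof. exact: (recog_comp not). Qed.

Lemma definable_all (P : nat -> E -> Prop) :
  definable k (fun e => P (e 0) (fun i => e i.+1)) ->
  definable k (fun e => forall x, P x e).
Proof.
move=> rP; apply: (recog_ext (f := fun e => ~ exists x, ~ P x e)).
  move=> e; apply/propext; split=> [nP x|Px [x]]; last by apply.
  by apply: contrapT => Px; apply: nP; exists x.
by apply/definable_not/(definable_ex (P := fun x e => ~ P x e))/definable_not.
Qed.

(** The state is the carry, or [None] once a digit of the sum is wrong. *)
Lemma definable_add i j l : definable k (fun e => e i + e j = e l).
Proof.
exists (option bool),
  (fun (q : option bool) e => if q is Some c then e i + e j + c = e l else False),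
  (fun (r : nat -> 'I_k) (q : option bool) => if q is Some c then
     if (r i + r j + c) %% k == r l then Some (k <= r i + r j + c) else None
   else None), (Some false).
split=> [e|[c|] e r //]; first by rewrite addn0.
have := ltn_ord (r i); have := ltn_ord (r j); have := ltn_ord (r l).
move: (nat_of_ord (r i)) (nat_of_ord (r j)) (nat_of_ord (r l)) => a b d hd hb ha.
apply/propext.
have hc : c <= 1 by case: (c).
have D : (a + b + c) %/ k = (k <= a + b + c).
  case: leqP => h; last by rewrite divn_small.
  rewrite -(subnK h) divnDr // divnn (ltnW hk) divn_small //; lia.
have := divn_eq (a + b + c) k; rewrite D.
have := ltn_pmod (a + b + c) (ltnW hk).
move: ((a + b + c) %% k) (k <= a + b + c) => m t hm Em.
have -> : (k * e i + a + (k * e j + b) + c = k * e l + d)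
  = (k * (e i + e j + t) + m = k * e l + d).
  by congr (_ = _); rewrite !mulnDr (mulnC k t); lia.
case: eqP => [->|nm]; split=> //; last 1 first.
- move=> h; apply: nm; move/(congr1 (modn^~ k)): h.
  by rewrite !(mulnC k) !modnMDl !modn_small.
- by move=> /addIn/eqP; rewrite eqn_pmul2l 1?ltnW // => /eqP.
- by move=> ->.
Qed.

(** A term is definable when its graph is; the environment is shifted to make room
for the value of the term as variable [0]. *)
Definition definable_term (t : E -> nat) :=
  definable k (fun e => t (fun i => e i.+1) = e 0).

Lemma definable_subst (P : nat -> E -> Prop) t : definable_term t ->
  definable k (fun e => P (e 0) (fun i => e i.+1)) -> definable k (fun e => P (t e) e).
Proof.
move=> rt rP; apply: (recog_ext (f := fun e => exists x, t e = x /\ P x e)).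
  by move=> e; apply/propext; split=> [[x [-> //]]|Pe]; exists (t e).
by apply/(definable_ex (P := fun x e => t e = x /\ P x e))/definable_and.
Qed.

Lemma definable_leq_var i j : definable k (fun e => e i <= e j).
Proof.
apply: (recog_ext (f := fun e => exists z, e i + z = e j)) => [e|].
  apply/propext; split=> [[z <-]|h]; first exact: leq_addr.
  by exists (e j - e i); rewrite subnKC.
exact/(definable_ex (P := fun z e => e i + z = e j))/definable_add.
Qed.

Lemma definable_eq_var i j : definable k (fun e => e i = e j).
Proof.
apply: (recog_ext (f := fun e => e i <= e j /\ e j <= e i)) => [e|].
  by apply/propext; split=> [[? ?]|->] //; apply/eqP; rewrite eqn_leq; apply/andP.
by apply: definable_and; apply: definable_leq_var.
Qed.

Lemma definable_term_var i : definable_term (fun e => e i).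
Proof. exact: definable_eq_var. Qed.

Lemma definable_term_shift t v :
  definable_term t -> definable_term (fun e => t (fun i => e (v i))).
Proof.
move=> rt.
exact: (recog_reindex (fun i => if i is j.+1 then (v j).+1 else 0) rt).
Qed.

Lemma definable_term_add t u :
  definable_term t -> definable_term u -> definable_term (fun e => t e + u e).
Proof.
move=> rt ru.
apply: (definable_subst (P := fun x e => x + u (fun i => e i.+1) = e 0)).
  exact: (definable_term_shift succn rt).
apply: (definable_subst (P := fun y e => e 0 + y = e 1)).
  exact: (definable_term_shift (fun i => i.+2) ru).
exact: definable_add.
Qed.

Lemma definable_leq t u :
  definable_term t -> definable_term u -> definable k (fun e => t e <= u e).
Proof.
move=> rt ru; apply: (definable_subst (P := fun x e => x <= u e)) => //.
apply: (definable_subst (P := fun y e => e 0 <= y)); last exact: definable_leq_var.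
exact: (definable_term_shift succn ru).
Qed.

Lemma definable_eq t u :
  definable_term t -> definable_term u -> definable k (fun e => t e = u e).
Proof.
move=> rt ru; apply: (definable_subst (P := fun x e => x = u e)) => //.
apply: (definable_subst (P := fun y e => e 0 = y)); last exact: definable_eq_var.
exact: (definable_term_shift succn ru).
Qed.

Lemma definable_term0 : definable_term (fun=> 0).
Proof.
apply: (recog_ext (f := fun e => forall y, e 0 <= y)) => [e|].
  apply/propext; split=> [/(_ 0)|<- //].
  by rewrite leqn0 => /eqP.
exact/(definable_all (P := fun y e => e 0 <= y))/definable_leq_var.
Qed.

Lemma definable_term1 : definable_term (fun=> 1).
Proof.
apply: (recog_ext (f := fun e => ~ (e 0 <= 0) /\ forall y, y <= 0 \/ e 0 <= y)) => [e|].
  apply/propext; split=> [[h /(_ 1)]|<-]; first lia.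
  by split=> // y; case: y; [left|right].
apply: definable_and.
  by apply/definable_not/definable_leq;
      [apply: definable_term_var|apply: definable_term0].
apply/(definable_all (P := fun y e => y <= 0 \/ e 0 <= y))/definable_or.
  by apply: definable_leq; [apply: definable_term_var|apply: definable_term0].
exact: definable_leq_var.
Qed.

Lemma definable_termS t : definable_term t -> definable_term (fun e => (t e).+1).
Proof.
move=> rt; apply: (recog_ext _ (definable_term_add rt definable_term1)) => e.
by rewrite addn1.
Qed.

Lemma definable_lt t u :
  definable_term t -> definable_term u -> definable k (fun e => t e < u e).
Proof. by move=> rt; apply: definable_leq; apply: definable_termS. Qed.

Lemma definable_eq_seq (T : Type) (s : nat -> T) t u : recog k (fun e => s (e 0)) ->
  definable_term t -> definable_term u -> definable k (fun e => s (t e) = s (u e)).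
Proof.
move=> rs rt ru; apply: (definable_subst (P := fun x e => s x = s (u e))) => //.
apply: (definable_subst (P := fun y e => s (e 0) = s y)).
  exact: (definable_term_shift succn ru).
apply: recog_comp2; first exact: (recog_reindex (fun=> 1) rs).
exact: (recog_reindex (fun=> 0) rs).
Qed.

End Recognizable.

(** * Automatic and regular sequences *)

Section Automata.
Variable k : nat.
Hypothesis hk : 2 <= k.

Lemma base_rep_rcons n x (c : 'I_k) : base_rep n x -> 0 < k * n + c ->
  base_rep (k * n + c) (rcons x c).
Proof.
move=> [xn lead] pos; split; first by rewrite -cats1 foldl_cat /= xn mulnC.
case: x xn lead => [/= n0 _|a x _ lead] d y /= [<- _]; last exact: (lead a x).
by rewrite -n0 muln0 add0n in pos => c0; rewrite c0 in pos.
Qed.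

Lemma base_rep_inj n (x y : seq 'I_k) : base_rep n x -> base_rep n y -> x = y.
Proof.
have [z [_ uz]] := base_rep_unique_exists n hk.
by move=> /uz <- /uz <-.
Qed.

(** In base [k] the number [0] is the empty word, so a leading digit [0] must not
move the automaton. The extra state [None], which loops on [0], arranges this and
makes the recurrence hold for all [n] and [c]. *)
Lemma automatic_state (T : Type) (s : nat -> T) : automatic k s ->
  exists (Q : finType) (state : nat -> Q) (delta : Q -> 'I_k -> Q) (tau : Q -> T),
    (forall n, s n = tau (state n)) /\
    (forall n (c : 'I_k), state (k * n + c) = delta (state n) c).
Proof.
move=> [Q [q0 [delta [tau Hs]]]].
pose delta' (o : option Q) (c : 'I_k) : option Q :=
  if o is Some q then Some (delta q c)
  else if (c : nat) == 0 then None else Some (delta q0 c).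
have rep n : {x : seq 'I_k | base_rep n x}.
  by apply: cid; have [x [? _]] := base_rep_unique_exists n hk; exists x.
pose state n := foldl delta' None (sval (rep n)).
exists (option Q), state, delta', (fun o => tau (odflt q0 o)); split=> [n|n c].
  rewrite /state; case: (rep n) => x /= Hx.
  rewrite (Hs n x Hx); congr tau; case: Hx => _ lead.
  case: x lead => //= c x /(_ c x erefl) /eqP/negPf ->.
  by elim: x (delta q0 c) => //= d x IH q; rewrite IH.
rewrite /state; have [|pos] := posnP (k * n + c).
  move=> /eqP; rewrite addn_eq0 muln_eq0 => /andP[/orP[/eqP k0|/eqP n0] /eqP c0].
    by exfalso; move: hk; clear -k0; lia.
  have nil0 : base_rep 0 ([::] : seq 'I_k) by split.
  rewrite n0 c0 muln0 addn0; case: (rep 0) => x /= Hx.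
  by rewrite (base_rep_inj Hx nil0) /= c0 eqxx.
case: (rep n) => x Hx; case: (rep (k * n + c)) => y Hy /=.
rewrite (base_rep_inj Hy (base_rep_rcons Hx pos)).
by rewrite -cats1 foldl_cat.
Qed.

Lemma recog_automatic (T : Type) (s : nat -> T) :
  automatic k s -> recog k (fun e => s (e 0)).
Proof.
move=> /automatic_state[Q [state [delta [tau [s_tau stateS]]]]].
exists {ffun Q -> Q}, (fun (p : {ffun Q -> Q}) e => tau (p (state (e 0)))),
  (fun (r : nat -> 'I_k) (p : {ffun Q -> Q}) => [ffun q => p (delta q (r 0))]),
  [ffun q => q].
by split=> [e|p e r]; rewrite ffunE ?s_tau ?stateS.
Qed.

(** The digits of [n], most significant first, act in the opposite order on the
states of the recognizer, so the automaton computes the composite map on states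
and evaluates at [0] in the end. This needs no finiteness of [T]. *)
Lemma automatic_recog (T : Type) (s : nat -> T) :
  recog k (fun e => s (e 0)) -> automatic k s.
Proof.
move=> [Q [F [step [q0 [F0 FS]]]]].
pose delta (p : {ffun Q -> Q}) (c : 'I_k) := [ffun q => p (step (fun=> c) q)].
pose id0 : {ffun Q -> Q} := [ffun q => q].
exists {ffun Q -> Q}, id0, delta, (fun p : {ffun Q -> Q} => F (p q0) (fun=> 0)).
move=> n x [xn _]; rewrite -(F0 (fun=> n)).
elim/last_ind: x n xn q0 {s F0} => [|x c IH] n xn q.
  by rewrite -xn /= ffunE.
move: xn; rewrite -cats1 !foldl_cat /= => xn.
rewrite ffunE -(IH _ erefl) -FS -xn; congr F.
by apply/funext => i; rewrite mulnC.
Qed.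

(** Finitely many integer sequences [V i] whose values at [k * n + c] are fixed
linear combinations of their values at [n]: the row vector of the [V i n] is
obtained from that at [0] by multiplying with one matrix per digit. *)
Lemma regular_lin (I : finType) (V : I -> nat -> int) (M : 'I_k -> I -> I -> int)
    (z : I -> int) (t : nat -> int) :
  (forall i n (c : 'I_k), V i (k * n + c) = \sum_j V j n * M c j i)%R ->
  (forall n, t n = \sum_i V i n * z i)%R -> regular k t.
Proof.
move=> HV Ht.
pose zeta c := (\matrix_(i < #|I|, j < #|I|) M c (enum_val i) (enum_val j))%R.
pose v n := (\row_(i < #|I|) V (enum_val i) n)%R.
exists #|I|, (v 0), (\col_i z (enum_val i))%R, zeta => n x [xn _].
have vS m (c : 'I_k) : (v m *m zeta c = v (m * k + c)%N)%R.
  apply/rowP => i; rewrite !mxE mulnC HV [RHS](reindex_onto enum_val enum_rank) => [|j _].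
    by apply: eq_big => [j|j _]; rewrite ?enum_valK ?eqxx // !mxE.
  exact: enum_rankK.
have vx m : (v m *m (\big[mulmx/1%:M]_(c <- x) zeta c) =
             v (foldl (fun m (c : 'I_k) => m * k + c)%N m x))%R.
  elim: x m {xn} => [|c x IH] m; first by rewrite big_nil mulmx1.
  by rewrite big_cons mulmxA vS IH.
rewrite vx xn Ht mxE [LHS](reindex_onto enum_val enum_rank) => [|j _]; last first.
  exact: enum_rankK.
by apply: eq_big => [j|j _]; rewrite ?mxE // enum_valK eqxx.
Qed.

(** Splitting the sum of [G q] over [m < k * n + c] according to the last digit of
[m] gives sums over [m < n] of the [G (st d q)], plus at most [k] boundary values.
Hence the partial sums, the [G q] themselves and the constant [1] form a family
to which [regular_lin] applies. *)
Lemma regular_sum (f : nat -> int) (a : int) : recog k (fun e => f (e 0)) ->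
  regular k (fun n => a + \sum_(m < n) f m)%R.
Proof.
move=> [Q [F [step [q0 [F0 FS]]]]].
pose st (c : 'I_k) q := step (fun=> c) q.
pose G q n := F q (fun=> n).
have GS q n (c : 'I_k) : G q (k * n + c) = G (st c q) n.
  by rewrite /G -(FS q (fun=> n) (fun=> c)).
have f0 n : f n = G q0 n by rewrite /G F0.
pose D q n := (\sum_(m < n) G q m)%R.
have DS q n (c : 'I_k) : (D q (k * n + c)%N =
    \sum_(d < k) D (st d q) n + \sum_(d < k | (d < c)%N) G (st d q) n)%R.
  have Dk m : (D q (k * m)%N = \sum_(d < k) D (st d q) m)%R.
    elim: m => [|m IH].
      by rewrite muln0 /D big_ord0 big1 // => d _; rewrite big_ord0.
    rewrite mulnS addnC /D big_split_ord -/(D q (k * m)%N) IH.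
    rewrite [RHS](eq_bigr (fun d : 'I_k => D (st d q) m + G q (k * m + d)%N)%R).
      by rewrite big_split.
    by move=> d _; rewrite GS /D big_ord_recr.
  rewrite /D big_split_ord -/(D q (k * n)) Dk; congr (_ + _)%R.
  rewrite (big_ord_widen k (fun d => G q (k * n + d)%N)) 1?ltnW //.
  by apply: eq_bigr => d _; rewrite /= GS.
pose V (i : Q + Q + unit) n : int :=
  match i with inl (inl q) => D q n | inl (inr q) => G q n | inr _ => 1%R end.
pose M (c : 'I_k) (j i : Q + Q + unit) : int :=
  match i, j with
  | inl (inl q), inl (inl p) => (#|[pred d | st d q == p]|%:Z)%R
  | inl (inl q), inl (inr p) => (#|[pred d : 'I_k | (d < c)%N && (st d q == p)]|%:Z)%R
  | inl (inr q), inl (inr p) => ((p == st c q)%:Z)%R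
  | inr _, inr _ => 1%R
  | _, _ => 0%R
  end.
pose z (i : Q + Q + unit) : int :=
  match i with inl (inl q) => ((q == q0)%:Z)%R | inl (inr q) => 0%R | inr _ => a end.
have sumst (P : pred 'I_k) (H : Q -> int) q :
    (\sum_p H p * #|[pred d | P d && (st d q == p)]|%:Z = \sum_(d | P d) H (st d q))%R.
  rewrite [RHS](partition_big (fun d => st d q) xpredT) //=.
  apply: eq_bigr => p _; rewrite (eq_bigr (fun=> H p)) => [|d /andP[_ /eqP->] //].
  by rewrite sumr_const -mulr_natr natz.
have sum_unit (H : unit -> int) : (\sum_i H i = H tt)%R.
  by apply: big_pred1 => -[].
apply: (@regular_lin _ V M z) => [i n c|n]; rewrite !big_sumType sum_unit /=; last first.
  rewrite (bigD1 q0) //= eqxx mulr1.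
  rewrite [X in (_ = _ + X + _ + _)%R]big1 => [|q /negPf ->]; last by rewrite mulr0.
  rewrite [X in (_ = _ + X + _)%R]big1 => [|q _]; last by rewrite mulr0.
  rewrite !addr0.
  by rewrite mul1r addrC; congr (_ + _)%R; apply: eq_bigr => m _; rewrite f0.
case: i => [[q|q]|[]] /=; last 1 first.
- by rewrite !big1 ?add0r ?mulr1 // => q _; rewrite mulr0.
- rewrite DS !(sumst xpredT) // (sumst (fun d : 'I_k => d < c)) mulr0 addr0.
  by [].
- rewrite GS mulr0 addr0 big1 ?add0r => [|p _]; last by rewrite mulr0.
  by rewrite (bigD1 (st c q)) //= eqxx mulr1 big1 ?addr0 // => p /negPf ->; rewrite mulr0.
Qed.

End Automata.

(** * Addresses of the windows of an automatic sequence *)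

Lemma ex_least (P : nat -> Prop) : (exists i, P i) ->
  exists i, P i /\ forall j, j < i -> ~ P j.
Proof.
move=> [i Pi]; have ex : exists i, `[<P i>] by exists i; apply/asboolP.
case: (ex_minnP ex) => j /asboolP Pj jmin; exists j; split=> // a aj /asboolP Pa.
by have := jmin a Pa; rewrite leqNgt aj.
Qed.

Lemma leq_same_div x y d : x %/ d.+1 = y %/ d.+1 -> x <= y + d.
Proof.
move=> xy; rewrite (divn_eq x d.+1) xy {2}(divn_eq y d.+1) -addnA leq_add2l.
by rewrite -ltnS (leq_trans (ltn_pmod x (ltn0Sn d))) // ltnS leq_addl.
Qed.

Section Locate.
Variables (k : nat) (T : Type) (s : nat -> T).
Hypotheses (hk : 2 <= k) (hs : automatic k s).

(** The address of position [i] consists of the states at the two consecutive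
blocks of length [k ^ up_log k n >= n] that contain the window at [i], and of the
offset of [i] in the first one, rounded to a multiple of [(n %/ c).+1]. As the
block length is at most [k * n], there are at most [k * c + 1] rounded offsets,
whatever [n] is. *)
Lemma automatic_locate c : 0 < c -> exists L : finType, forall n, 0 < n ->
  exists loc : nat -> L, forall i j, loc i = loc j ->
  exists2 d, d <= n %/ c &
    (forall x, x + d < n -> s (i + d + x) = s (j + x)) \/
    (forall x, x + d < n -> s (i + x) = s (j + d + x)).
Proof.
move=> c0; have [Q [state [delta [tau [s_tau stateS]]]]] := automatic_state hk hs.
have k0 : 0 < k by exact: ltnW.
(* the content of a block only depends on the state at its index *)
have block e p q r : state p = state q -> r < k ^ e ->
    state (k ^ e * p + r) = state (k ^ e * q + r).
  move=> pq; elim: e r => [|e IH] r.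
    by rewrite expn0 ltnS leqn0 => /eqP ->; rewrite !mul1n !addn0.
  rewrite expnS => hr.
  have E t : k * k ^ e * t + r = k * (k ^ e * t + r %/ k) + Ordinal (ltn_pmod r k0).
    by rewrite /= {1}(divn_eq r k); lia.
  by rewrite !E !stateS IH // ltn_divLR // mulnC.
exists (Q * Q * 'I_(k * c).+1)%type => n n0.
pose b := k ^ up_log k n.
have nb : n <= b by exact: up_logP.
have bn : b <= k * n.
  rewrite /b; case: n n0 {b nb} => [//|[|n]] _; first by rewrite up_log1 muln1.
  have := up_log_gtn hk (isT : 1 < n.+2).
  case: (up_log k n.+2) => [|e] /=; last by rewrite expnS leq_pmul2l // => /ltnW.
  by rewrite expn0 muln_gt0 k0.
have b0 : 0 < b by rewrite expn_gt0 k0.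
exists (fun i => (state (i %/ b), state (i %/ b).+1, inord ((i %% b) %/ (n %/ c).+1))).
move=> i j [E1 E2 E3].
have o_lt t : t %% b < b by exact: ltn_pmod.
have nc : n < c * (n %/ c).+1 by rewrite mulnC -ltn_divLR.
have box t : (t %% b) %/ (n %/ c).+1 < (k * c).+1.
  rewrite ltn_divLR //.
  by apply: leq_trans (o_lt t) _; apply: leq_trans bn _; nia.
have {E3} E3 : (i %% b) %/ (n %/ c).+1 = (j %% b) %/ (n %/ c).+1.
  by have := congr1 (@nat_of_ord _) E3; rewrite !inordK.
have same y : y < b + b -> s (b * (i %/ b) + y) = s (b * (j %/ b) + y).
  move=> hy; rewrite !s_tau; congr tau.
  have [yb|by_] := ltnP y b; first exact: block.
  have E t : b * t + y = b * t.+1 + (y - b) by rewrite mulnS (addnC b) -addnA subnKC.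
  by rewrite !E; apply: block => //; rewrite -/b ltn_subLR.
have := leq_same_div E3; have := leq_same_div (esym E3).
have := divn_eq i b; have := divn_eq j b; rewrite -!(mulnC b).
have := o_lt i; have := o_lt j.
move: same nb; clear; move: (i %% b) (j %% b) (b * (i %/ b)) (b * (j %/ b)) (n %/ c).
move: b => b o o' p p' d same nb ho' ho Ej Ei oo' o'o.
have [oij|oji] := leqP o o'.
  exists (o' - o); first by clear -o'o oo'; lia.
  left=> x hx; have -> : i + (o' - o) + x = p + (o' + x) by clear -Ei oij; lia.
  by rewrite same; [congr s; clear -Ej; lia|clear -nb ho' hx oij; lia].
exists (o - o'); first by clear -o'o oo'; lia.
right=> x hx; have -> : j + (o - o') + x = p' + (o + x) by clear -Ej oji; lia.
by rewrite -same; [congr s; clear -Ei; lia|clear -nb ho hx oji; lia].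
Qed.

End Locate.

(** * Periodic words and their runs of short period *)

Section Periodic.
Variable A : Type.
Implicit Types (f g : nat -> A).

Definition periodic f l := forall x, f (x + l) = f x.

Lemma periodic_mul f l j x : periodic f l -> f (x + j * l) = f x.
Proof. by move=> fl; elim: j => [|j IH]; rewrite ?addn0 // mulSn addnCA addnC fl. Qed.

Lemma periodic_shift f l i : periodic f l -> periodic (fun x => f (i + x)) l.
Proof. by move=> fl x; rewrite addnA fl. Qed.

(** A form of the theorem of Fine and Wilf: from the back, [x - a], [x - b] and
[x - a - b] propagate the agreement to [x]. *)
Lemma periodic_agree f g a b : periodic f a -> periodic g b -> 0 < a -> 0 < b ->
  (forall x, x < a + b -> f x = g x) -> forall x, f x = g x.
Proof.
move=> fa gb a0 b0 fg; elim/ltn_ind=> x IH.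
have [/fg //|xab] := ltnP x (a + b).
have back h c y : periodic h c -> c <= y -> h y = h (y - c).
  by move=> hc cy; rewrite -{1}(subnK cy) hc.
rewrite (back f a) // ?IH; [|lia|lia].
rewrite (back g b) //; last lia.
rewrite -IH; last lia.
have -> : x - a - b = x - b - a by lia.
rewrite -(back f a) //; last lia.
by rewrite IH; [rewrite -(back g b)//|]; lia.
Qed.

Definition windows n f : set (seq A) :=
  [set mkseq (fun x => f (i + x)) n | i in [set: nat]].

Lemma windows_shift n f l o : periodic f l -> 0 < l ->
  windows n (fun x => f (o + x)) = windows n f.
Proof.
move=> fl l0; apply/seteqP; split=> _ [i _ <-].
  by exists (o + i) => //; apply: eq_mkseq => x; rewrite addnA.
exists (i + (o * l - o)) => //; apply: eq_mkseq => x.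
rewrite -(periodic_mul o (i + x) fl); congr f.
by have : o <= o * l by [rewrite leq_pmulr]; lia.
Qed.

Lemma windows_eq n f g l l' a b : periodic f l -> periodic g l' -> 0 < l -> 0 < l' ->
  (forall x, f (a + x) = g (b + x)) -> windows n f = windows n g.
Proof.
move=> fl gl l0 l'0 fg.
rewrite -(windows_shift n a fl l0) -(windows_shift n b gl l'0).
by congr windows; apply/funext.
Qed.

End Periodic.

(** The constants below are tuned to the precision [D] of addresses. Periods up to
[2 * D] are short, because the difference of two shifts can be that large. A
break of a run is looked at with a margin [5 * D] on its left, which leaves room
for one shift and two short periods. A run is long when it has length [10 * D]:
the margin, plus the same slack again. Finally [n] is at least [24 * D], so that
[n - 12 * D], the distance of the five probes, is at least half of [n]. *)
Section Codes.
Variables (A : Type) (n : nat).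
Implicit Types (F G : nat -> A).
Local Notation D := (n %/ 24).

Definition near (f : nat -> A) i (g : nat -> A) j := exists2 d, d <= D &
    (forall x, x + d < n -> f (i + d + x) = g (j + x)) \/
    (forall x, x + d < n -> f (i + x) = g (j + d + x)).

Definition has_per (f : nat -> A) i p h :=
  forall x, x + p < h -> f (i + x) = f (i + x + p).

(** A periodic word [F] with period [l], normalized so that a long run of its
smallest possible short period [p] breaks at the letter [5 * D]. By periodicity a
run ends again at [5 * D + l]; [g] is the last position before that run, so
[g.+1] is its start. *)
Record long_run F l p g : Prop := LongRun {
  lr_l : 0 < l <= n;
  lr_per : periodic F l;
  lr_p : 0 < p <= 2 * D;
  lr_min : forall i q, 0 < q < p -> ~ has_per F i q (10 * D);
  lr_before : forall x, x + p < 5 * D -> F x = F (x + p);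
  lr_break : F (5 * D - p) <> F (5 * D);
  lr_g_ge : 5 * D <= g + p;
  lr_g_le : g + 1 + 10 * D <= 5 * D + l;
  lr_run : forall x, g < x -> x + p < 5 * D + l -> F x = F (x + p);
  lr_start : F g <> F (g + p) }.

Lemma leq_div24 : D * 24 <= n. Proof. exact: leq_trunc_div. Qed.

(** A break is rigid: if a nonzero shift by [d] took one word to the other, the
letter at the first break would be forced to continue its run, by going back one
period of the other run, one of its own run, and forward again. *)
Lemma right_break F G l p g l' p' g' d :
  long_run F l p g -> long_run G l' p' g' -> 0 < d <= D ->
  (forall x, x + d < n -> F (d + x) = G x) -> False.
Proof.
move=> rF rG hd FG; have hp := lr_p rF; have hp' := lr_p rG; have N := leq_div24.
apply: (lr_break rF); move: (lr_before rF) (lr_before rG) FG.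
move: (D) hp hp' hd N => {rF rG}D hp hp' hd N runF runG FG.
have e1 : F (5 * D) = G (5 * D - d) by rewrite -FG; [congr F|]; lia.
have e2 : G (5 * D - d) = G (5 * D - d - p').
  by rewrite [RHS]runG; [congr G|]; lia.
have e3 : G (5 * D - d - p') = F (5 * D - p') by rewrite -FG; [congr F|]; lia.
have e4 : F (5 * D - p') = F (5 * D - p' - p).
  by rewrite [RHS]runF; [congr F|]; lia.
have e5 : F (5 * D - p' - p) = G (5 * D - d - p - p') by rewrite -FG; [congr F|]; lia.
have e6 : G (5 * D - d - p - p') = G (5 * D - d - p).
  by rewrite [LHS]runG; [congr G|]; lia.
have e7 : G (5 * D - d - p) = F (5 * D - p) by rewrite -FG; [congr F|]; lia.
by rewrite e1 e2 e3 e4 e5 e6 e7.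
Qed.

(** The mirror image of [right_break], for the start of a run. *)
Lemma left_break F G l p l' p' g d :
  long_run F l p g -> long_run G l' p' g -> 0 < d <= D ->
  (forall x, x + d < n -> F (g + d + x) = G (g + x)) -> False.
Proof.
move=> rF rG hd FG; have hp := lr_p rF; have hp' := lr_p rG; have N := leq_div24.
have hg := lr_g_le rF; have hg' := lr_g_le rG.
apply: (lr_start rG); move: (lr_run rF) (lr_run rG) FG.
move: (D) hp hp' hd N hg hg' => {rF rG}D hp hp' hd N hg hg' runF runG FG.
have FG0 : G g = F (g + d) by rewrite -{1}(addn0 g) -FG ?addn0 //; lia.
rewrite FG0 runF; [|lia|lia].
rewrite FG; [|lia]; rewrite runG; [|lia|lia].
rewrite -addnA -FG; [|lia].
have -> : g + d + (p + p') = g + d + p' + p by lia.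
rewrite -runF; [|lia|lia]; rewrite FG //; lia.
Qed.

(** Where two words agree, the run of one cannot start inside the run of the other;
this is the argument of [left_break] for a shift by [0]. *)
Lemma start_eq F G l p g l' p' g' :
  long_run F l p g -> long_run G l' p' g' -> l <= l' + D ->
  (forall x, x < n -> F x = G x) -> g' < g -> False.
Proof.
move=> rF rG ll' FG gg; have hp := lr_p rF; have hp' := lr_p rG; have N := leq_div24.
have hg := lr_g_le rF; have hg' := lr_g_le rG; have hl := lr_l rF.
apply: (lr_start rF); move: (lr_run rF) (lr_run rG) FG.
move: (D) hp hp' ll' N hg hg' => {rF rG}D hp hp' ll' N hg hg' runF runG FG.
rewrite FG; [|lia]; rewrite runG; [|lia|lia].
rewrite -FG; [|lia]; rewrite runF; [|lia|lia].
have -> : g + p' + p = g + p + p' by lia.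
rewrite FG; [|lia]; rewrite -runG; [|lia|lia].
rewrite FG //; lia.
Qed.

(** The windows at the start of the run have length [n], so the end of the shorter
run is not seen and [n - l <= p]; as [l' = n] is excluded, [t = l' - l] is
smaller than [p]. The two words agree up to the end [5 * D + l] of the first run,
and both ends are translates of the same margin, so the run has period [t]. *)
Lemma run_length F G l p l' p' g :
  long_run F l p g -> long_run G l' p' g -> (l == n) = (l' == n) ->
  (forall x, x < n -> F x = G x) ->
  (forall x, x < n -> F (g + x) = G (g + x)) -> l < l' -> False.
Proof.
move=> rF rG ln FG0 FGg ll'; have hp := lr_p rF; have hp' := lr_p rG; have N := leq_div24.
have hg := lr_g_le rF; have hg' := lr_g_le rG; have hl := lr_l rF.
have hl' := lr_l rG; have hge := lr_g_ge rF.
have l'n : l' < n.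
  rewrite ltn_neqAle -ln; case/andP: hl' => _ ->; rewrite andbT.
  by apply/eqP; lia.
have FG x : x < g + n -> F x = G x.
  move=> hx; have [/FG0 //|nx] := ltnP x n.
  by rewrite -(@subnKC g x) ?FGg //; lia.
have bF := lr_break rF; have mF := lr_min rF; have pF := lr_per rF.
have pG := lr_per rG.
move: (lr_run rF) (lr_run rG) => runF runG.
move: (D) hp hp' N hg hg' hge bF mF runF runG => {rF rG FG0 FGg ln} D.
move=> hp hp' N hg hg' hge bF mF runF runG.
(* otherwise the break of [F] at [5 * D + l] also breaks the run of [G] *)
have long : g + n <= 5 * D + l.
  rewrite leqNgt; apply/negP => vis; apply: bF.
  have Fm x : F x = F (x + l) by rewrite pF.
  rewrite (Fm (5 * D - p)) (Fm (5 * D)) [RHS]FG //.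
  have -> : 5 * D - p + l = 5 * D + l - p by lia.
  have -> : G (5 * D + l) = G (5 * D + l - p').
    by rewrite [RHS]runG; [congr G| |]; lia.
  rewrite -FG; last lia.
  have -> : F (5 * D + l - p') = F (5 * D + l - p - p').
    by rewrite [RHS]runF; [congr F| |]; lia.
  rewrite [RHS]FG; last lia.
  by rewrite [RHS]runG; [rewrite FG; [congr G|]| |]; lia.
pose t := l' - l; have Et : l' = l + t by rewrite /t; lia.
have ht : 0 < t < p by lia.
have perG x : g < x -> x + p < 5 * D + l' -> G x = G (x + p).
  elim/ltn_ind: x => x IH gx xl.
  have [vis|nvis] := ltnP (x + p) (g + n).
    by rewrite -!FG; [apply: runF|..]; lia.
  have -> : G x = G (x - p') by rewrite [RHS]runG; [congr G| |]; lia.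
  rewrite IH; [|lia|lia|lia].
  by rewrite runG; [congr G| |]; lia.
have {}FG x : x < 5 * D + l -> F x = G x.
  elim/ltn_ind: x => x IH xl.
  have [/FG //|nx] := ltnP x (g + n).
  have -> : F x = F (x - p) by rewrite [RHS]runF; [congr F| |]; lia.
  by rewrite IH; [rewrite perG; [congr G| |]| |]; lia.
(* on the last margin by translating both ends to [0]; then leftwards by [p] *)
have tG y : g < y -> y < l + 5 * D -> G y = G (y + t).
  move=> gy yl; have [c] := ubnP (l - y); elim: c y gy yl => // c IH y gy yl hc.
  have [ly|yl'] := leqP l y.
    rewrite -(subnKC ly); move: (y - l) (subnKC ly) => x Ex.
    rewrite -FG; last lia.
    rewrite addnC pF FG; last lia.
    by rewrite -[LHS]pG; congr G; lia.
  rewrite perG; [|lia|lia].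
  rewrite IH; [|lia|lia|lia].
  by rewrite [RHS]perG; [congr G| |]; lia.
apply: (mF g.+1 t ht) => x hx.
by rewrite FG; [rewrite tG; [rewrite -FG //| |]|]; lia.
Qed.

Lemma near_long_run F G l p g l' p' g' :
  long_run F l p g -> long_run G l' p' g' -> near F 0 G 0 ->
  forall x, x < n -> F x = G x.
Proof.
move=> rF rG [[|d] hd [FG|FG]] x hx; try by rewrite -[x]add0n FG ?addn0 //; lia.
  by case: (@right_break F G l p g l' p' g' d.+1 rF rG) => // y /FG; rewrite !add0n.
by case: (@right_break G F l' p' g' l p g d.+1 rG rF) => // y /FG; rewrite !add0n => ->.
Qed.

Lemma long_run_inj F G l p g l' p' g' :
  long_run F l p g -> long_run G l' p' g' -> near F 0 G 0 -> near F g G g' ->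
  l %/ D.+1 = l' %/ D.+1 -> (l == n) = (l' == n) -> forall x, F x = G x.
Proof.
move=> rF rG nr0 nrg ll ln.
have FG := near_long_run rF rG nr0.
have GF x : x < n -> G x = F x by move/FG.
have gg : g = g'.
  have [lt|lt|//] := ltngtP g g'.
    by case: (start_eq rG rF (leq_same_div (esym ll)) GF lt).
  by case: (start_eq rF rG (leq_same_div ll) FG lt).
rewrite -{}gg in rG nrg.
have FGg x : x < n -> F (g + x) = G (g + x).
  case: nrg => [[|d] hd [E|E]] hx; try by have := E x; rewrite !addn0 => -> //; lia.
    by case: (@left_break F G l p l' p' g d.+1 rF rG).
  by case: (@left_break G F l' p' l p g d.+1 rG rF) => // y /E ->.
have Ell : l = l'.
  have GFg x : x < n -> G (g + x) = F (g + x) by move/FGg.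
  have [lt|lt|//] := ltngtP l l'.
    by case: (run_length rF rG ln FG FGg).
  by case: (run_length rG rF (esym ln) GF GFg).
have /andP[l0 ln'] := lr_l rF.
move=> x; rewrite (divn_eq x l) addnC.
rewrite (periodic_mul _ _ (lr_per rF)) [in RHS]Ell (periodic_mul _ _ (lr_per rG)) -Ell.
by apply: FG; apply: leq_trans ln'; apply: ltn_pmod.
Qed.

End Codes.

Section Bounded.
Variables (A : Type) (s : nat -> A).
Implicit Types (f : nat -> A).

Definition cyclic_in n f :=
  (exists l, 0 < l <= n /\ periodic f l) /\
  (forall i, exists j, forall x, x < n -> f (i + x) = s (j + x)).

(** Take the least [p] for which some factor of length [10 * D] has period [p]. As
[p] is not a global period, the run continues to a first break, which is moved to
[5 * D]. The start of the next run is found by going back from its end to the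
last place where [p] fails. *)
Lemma long_run_exists n f l i0 p0 : 0 < l <= n -> periodic f l ->
  0 < p0 <= 2 * (n %/ 24) -> has_per f i0 p0 (10 * (n %/ 24)) ->
  (forall p, 0 < p <= 2 * (n %/ 24) -> ~ periodic f p) ->
  exists o p b, long_run n (fun x => f (o + x)) l p b.
Proof.
move=> hl fl hp0 run0 nper.
have [p [[p_gt0 [i run]] pmin]] :=
  @ex_least (fun p => 0 < p /\ exists i, has_per f i p (10 * (n %/ 24)))
    (ex_intro _ p0 (conj (proj1 (andP hp0)) (ex_intro _ i0 run0))).
have hp : 0 < p <= 2 * (n %/ 24).
  rewrite p_gt0 /=; case/andP: hp0 => p00; apply: leq_trans.
  rewrite leqNgt; apply/negP => lt; apply: (pmin _ lt); split=> //; by exists i0.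
have [B0 [brk0 B0min]] : exists t, f (i + t) <> f (i + t + p) /\
    forall t', t' < t -> ~ f (i + t') <> f (i + t' + p).
  apply: ex_least; apply: contrapT => none; apply: (nper p hp) => x.
  have -> : f x = f (i + (x + (i * l - i))).
    rewrite -(periodic_mul i x fl); congr f.
    by have : i <= i * l by [rewrite leq_pmulr; lia]; lia.
  have -> : f (x + p) = f (i + (x + (i * l - i)) + p).
    rewrite -(periodic_mul i (x + p) fl); congr f.
    by have : i <= i * l by [rewrite leq_pmulr; lia]; lia.
  by apply: contrapT => neq; apply: none; exists (x + (i * l - i)) => E; apply: neq.
have runB x : i <= x -> x < i + B0 -> f x = f (x + p).
  move=> ix xB; apply: contrapT => neq.
  by apply: (B0min (x - i)); [lia|rewrite subnKC].
have hB : 10 * (n %/ 24) <= B0 + p.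
  rewrite leqNgt; apply/negP => lt; apply: brk0; exact: run.
move: (leq_div24 n) hp hB => N hp hB.
pose o := i + B0 + p - 5 * (n %/ 24).
have oE : o + 5 * (n %/ 24) = i + B0 + p by rewrite /o; lia.
have brk : f (o + (5 * (n %/ 24) - p)) <> f (o + 5 * (n %/ 24)).
  have -> : o + (5 * (n %/ 24) - p) = i + B0 by lia.
  by rewrite oE.
have brkl : f (o + (5 * (n %/ 24) + l - p)) <> f (o + (5 * (n %/ 24) + l)).
  have -> : o + (5 * (n %/ 24) + l - p) = o + (5 * (n %/ 24) - p) + l by lia.
  by rewrite addnA !fl.
have runl x : x + 10 * (n %/ 24) >= 5 * (n %/ 24) + l -> x + p < 5 * (n %/ 24) + l ->
    f (o + x) = f (o + (x + p)).
  move=> h1 h2.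
  have -> : o + x = o + x - l + l by lia.
  have -> : o + (x + p) = o + x - l + p + l by lia.
  by rewrite !fl; apply: runB; lia.
have [t [[tle tbrk] tmin]] : exists t, (t + p < 5 * (n %/ 24) + l /\
    f (o + (5 * (n %/ 24) + l - p.+1 - t)) <> f (o + (5 * (n %/ 24) + l - p.+1 - t) + p)) /\
    forall t', t' < t -> ~ (t' + p < 5 * (n %/ 24) + l /\
    f (o + (5 * (n %/ 24) + l - p.+1 - t')) <> f (o + (5 * (n %/ 24) + l - p.+1 - t') + p)).
  apply: ex_least; exists l.-1; split; first lia.
  have -> : 5 * (n %/ 24) + l - p.+1 - l.-1 = 5 * (n %/ 24) - p by lia.
  by have -> : o + (5 * (n %/ 24) - p) + p = o + 5 * (n %/ 24) by lia.
exists o, p, (5 * (n %/ 24) + l - p.+1 - t).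
have tl : t <= l.-1.
  rewrite leqNgt; apply/negP => /tmin; apply; split; first lia.
  have -> : 5 * (n %/ 24) + l - p.+1 - l.-1 = 5 * (n %/ 24) - p by lia.
  by have -> : o + (5 * (n %/ 24) - p) + p = o + 5 * (n %/ 24) by lia.
split=> //.
- exact: periodic_shift.
- move=> j q /andP[q0 qp] run'; apply: (pmin q qp); split=> //.
  by exists (o + j) => x hx; rewrite -addnA run' // !addnA.
- by move=> x hx; rewrite addnA; apply: runB; lia.
- by lia.
- rewrite leqNgt; apply/negP => lt; apply: tbrk.
  by rewrite -addnA; apply: runl; lia.
- move=> x hx1 hx2; apply: contrapT => neq.
  apply: (tmin (5 * (n %/ 24) + l - p.+1 - x)); first lia.
  have -> : 5 * (n %/ 24) + l - p.+1 - (5 * (n %/ 24) + l - p.+1 - x) = x by lia.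
  by split; [lia|rewrite -addnA].
- by rewrite addnA.
Qed.

End Bounded.

(** * Finitely many codes for the periodic words inside an automatic sequence *)

Section NearWindows.
Variables (A : Type) (n : nat).
Implicit Types (f g : nat -> A).

(** A shift of either sign by at most [D] becomes a nonnegative shift by at most
[2 * D] once the window of [g] is cut by [D] on its left. *)
Lemma near_center f i g j : near n f i g j -> exists2 a, a <= 2 * (n %/ 24) &
  forall x, x + 2 * (n %/ 24) < n -> f (i + a + x) = g (j + n %/ 24 + x).
Proof.
have := leq_div24 n; rewrite /near; move: (n %/ 24) => D N [d hd [E|E]].
  exists (D + d); first lia.
  move=> x hx; rewrite -(addnA j) -E; last lia.
  by congr f; lia.
exists (D - d); first lia.
move=> x hx; rewrite -(addnA i) E; last lia.
by congr g; lia.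
Qed.

Lemma short_period_inj f g p q l l' : 0 < n -> 0 < l -> 0 < l' ->
  periodic f l -> periodic g l' ->
  0 < p <= 2 * (n %/ 24) -> 0 < q <= 2 * (n %/ 24) ->
  periodic f p -> periodic g q -> near n f 0 g 0 -> windows n f = windows n g.
Proof.
move=> n0 l0 l'0 fl gl hp hq fp gq /near_center[a ha E].
apply: (windows_eq n (a := a) (b := n %/ 24) fl gl l0 l'0).
move: (hp) (hq) => /andP[p0 _] /andP[q0 _].
apply: (periodic_agree (periodic_shift _ fp) (periodic_shift _ gq) p0 q0) => x hx.
by have := leq_div24 n; move=> N; rewrite -E //; lia.
Qed.

Definition probe t := t * (n - 12 * (n %/ 24)).

(** Consecutive probes overlap, after the loss of [2 * D], on a length [10 * D].
There two different shifts would make their difference a short period of [f]. *)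
Lemma no_run_inj f g l l' : 0 < n -> 0 < l <= n -> 0 < l' <= n ->
  periodic f l -> periodic g l' ->
  (forall i p, 0 < p <= 2 * (n %/ 24) -> ~ has_per f i p (10 * (n %/ 24))) ->
  (forall t, t < 5 -> near n f (probe t) g (probe t)) -> windows n f = windows n g.
Proof.
move=> n0 hl hl' fl gl nrun nr; have N := leq_div24 n.
have ex t : exists a, t < 5 -> a <= 2 * (n %/ 24) /\ forall x,
    x + 2 * (n %/ 24) < n -> f (probe t + a + x) = g (probe t + n %/ 24 + x).
  case: (ltnP t 5) => [lt|//]; last by exists 0.
  by have [a ? ?] := near_center (nr t lt); exists a.
have [a Ha] := choice ex.
have step t : t < 4 -> a t.+1 = a t.
  move=> t4; have [a1 E1] := Ha t (ltnW t4); have [a2 E2] := Ha t.+1 t4.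
  have pS : probe t.+1 = probe t + (n - 12 * (n %/ 24)) by rewrite /probe mulSn addnC.
  have both x : x + 2 * (n %/ 24) < n - (n - 12 * (n %/ 24)) ->
      f (probe t.+1 + a t.+1 + x) = f (probe t.+1 + a t + x).
    move=> hx; rewrite E2; last lia.
    have -> : probe t.+1 + a t + x = probe t + a t + (n - 12 * (n %/ 24) + x) by lia.
    by rewrite E1; [congr g|]; lia.
  have [lt|lt|//] := ltngtP (a t.+1) (a t).
    case: (nrun (probe t.+1 + a t.+1) (a t - a t.+1)); first lia.
    move=> x hx; rewrite both; last lia.
    by congr f; lia.
  case: (nrun (probe t.+1 + a t) (a t.+1 - a t)); first lia.
  move=> x hx; rewrite -both; last lia.
  by congr f; lia.
have aE t : t < 5 -> a t = a 0.
  by elim: t => // t IH lt; rewrite step ?IH //; apply: ltnW.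
apply: (windows_eq n (a := a 0) (b := n %/ 24) fl gl); [lia|lia|].
apply: (periodic_agree (periodic_shift _ fl) (periodic_shift _ gl)); [lia|lia|].
suff main t : t < 5 -> forall x, x + 2 * (n %/ 24) < probe t + n ->
    f (a 0 + x) = g (n %/ 24 + x).
  by move=> x hx; apply: (main 4 isT); rewrite /probe; lia.
elim: t => [|t IH] t5 x hx.
  by have [_ E] := Ha 0 isT; have := E x; rewrite /probe mul0n !add0n; apply.
have [lt|ge] := ltnP (x + 2 * (n %/ 24)) (probe t + n).
  by apply: IH => //; apply: ltnW.
have [_] := Ha t.+1 t5; rewrite aE // => /(_ (x - probe t.+1)) E.
have pS : probe t.+1 = probe t + (n - 12 * (n %/ 24)) by rewrite /probe mulSn addnC.
have -> : a 0 + x = probe t.+1 + a 0 + (x - probe t.+1) by lia.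
by rewrite E; [congr g|]; lia.
Qed.

End NearWindows.

Section Code.
Variables (k : nat) (A : Type) (s : nat -> A).
Hypotheses (hk : 2 <= k) (hs : automatic k s).

(** Besides addresses, the code of a word with a long run records its period [l]
rounded to a multiple of [D.+1], and whether [l = n]; these are the hypotheses of
[long_run_inj]. The rounded period is at most [24]. *)
Theorem windows_code : exists C : finType, forall n, 0 < n ->
  exists code : (nat -> A) -> C, forall f g,
  cyclic_in s n f -> cyclic_in s n g -> code f = code g -> windows n f = windows n g.
Proof.
have [L HL] := automatic_locate hk hs (isT : 0 < 24).
exists (L + {ffun 'I_5 -> L} + (L * L * 'I_25 * bool))%type => n n0.
have [loc Hloc] := HL n n0.
pose at_ f i a := exists j, (forall x, x < n -> f (i + x) = s (j + x)) /\ loc j = a.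
have at_ex f i : cyclic_in s n f -> exists a, at_ f i a.
  by move=> [_ /(_ i)[j E]]; exists (loc j), j.
have at_near f i g j a : at_ f i a -> at_ g j a -> near n f i g j.
  move=> [i' [Ei <-]] [j' [Ej Eij]].
  have [d hd E] := Hloc i' j' (esym Eij); exists d => //.
  case: E => E; [left|right] => x hx.
    by rewrite -(addnA i) Ei ?Ej ?addnA ?E //; lia.
  by rewrite -(addnA j) Ei ?Ej ?addnA ?E //; lia.
pose code f (c : L + {ffun 'I_5 -> L} + (L * L * 'I_25 * bool)) : Prop :=
  match c with
  | inl (inl a) => at_ f 0 a /\ exists2 p, 0 < p <= 2 * (n %/ 24) & periodic f p
  | inl (inr a) => (forall t : 'I_5, at_ f (probe n t) (a t)) /\
      forall i p, 0 < p <= 2 * (n %/ 24) -> ~ has_per f i p (10 * (n %/ 24))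
  | inr (a, b, q, e) => exists o l p u, [/\ long_run n (fun x => f (o + x)) l p u,
      periodic f l, at_ f o a, at_ f (o + u) b
      & q = l %/ (n %/ 24).+1 :> nat /\ e = (l == n)]
  end.
have ex f : exists c, cyclic_in s n f -> code f c.
  case: (pselect (cyclic_in s n f)) => [cf|ncf]; last first.
    by have [a _] := HL 1 isT; exists (inl (inl (a 0))).
  have [[l [hl fl]] _] := cf.
  case: (pselect (exists2 p, 0 < p <= 2 * (n %/ 24) & periodic f p)) => [per|nper].
    by have [a Ha] := at_ex f 0 cf; exists (inl (inl a)).
  case: (pselect (exists i p, 0 < p <= 2 * (n %/ 24) /\ has_per f i p (10 * (n %/ 24)))).
    move=> [i [p [hp run]]].
    have [|o [p' [u H]]] := long_run_exists hl fl hp run.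
      by move=> q hq fq; apply: nper; exists q.
    have [a Ha] := at_ex f o cf; have [b Hb] := at_ex f (o + u) cf.
    have lq : l %/ (n %/ 24).+1 < 25.
      rewrite ltn_divLR //; apply: leq_ltn_trans (proj2 (andP hl)) _.
      by rewrite {1}(divn_eq n 24); have := ltn_pmod n (isT : 0 < 24); lia.
    by exists (inr (a, b, Ordinal lq, l == n)) => _; exists o, l, p', u; split.
  move=> nrun; have [a Ha] := choice (fun t => at_ex f (probe n t) cf).
  exists (inl (inr [ffun t : 'I_5 => a t])) => _; split=> [t|i p hp run].
    by rewrite ffunE.
  by apply: nrun; exists i, p.
have [c Hc] := choice ex; exists c => f g cf cg E.
have := Hc g cg; have := Hc f cf; rewrite -E.
have [[l [hl fl]] _] := cf; have [[l' [hl' gl]] _] := cg.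
case: (c f) => [[a|a]|[[[a b] q] e]] /=.
- move=> [af [p hp fp]] [ag [p' hp' gp]].
  apply: (short_period_inj n0 _ _ fl gl hp hp' fp gp (at_near _ _ _ _ _ af ag)); lia.
- move=> [af nrun] [ag _]; apply: (no_run_inj n0 hl hl' fl gl nrun) => t ht.
  exact: at_near (af (Ordinal ht)) (ag (Ordinal ht)).
move=> [o [m [p [u [rf fm af bf [Eq Ee]]]]]] [o' [m' [p' [u' [rg gm ag bg [Eq' Ee']]]]]].
apply: (windows_eq n (a := o) (b := o') fm gm).
- by case/andP: (lr_l rf).
- by case/andP: (lr_l rg).
apply: (long_run_inj rf rg).
- case: (at_near _ _ _ _ _ af ag) => d hd H; exists d => //.
  by case: H => H; [left|right] => x /H; rewrite !add0n !addnA.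
- case: (at_near _ _ _ _ _ bf bg) => d hd H; exists d => //.
  by case: H => H; [left|right] => x /H; rewrite !addnA.
- by rewrite -Eq -Eq'.
- by rewrite -Ee -Ee'.
Qed.

End Code.

(** * Formulas for the cyclic words of a sequence *)

Section Formulas.
Variables (A : finType) (s : nat -> A).

(** This says that the window of [s] at [a] is the window at [j] of the periodic
word with period [s i, .., s (i + l - 1)]: the first [l] letters are compared
before and after the wrap-around, the others by periodicity. Neither a remainder
nor a product occurs, so that the formula is definable. *)
Definition cycle_at n i l j a : Prop :=
  [/\ forall x y, x < n -> y < l -> x + j = y -> s (a + x) = s (i + y),
      forall x y, x < n -> y < l -> x + j = y + l -> s (a + x) = s (i + y)
    & forall x, x + l < n -> s (a + x) = s (a + (x + l))].

Lemma cycle_atP n i l j a : j < l ->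
  cycle_at n i l j a <-> (forall x, x < n -> s (a + x) = s (i + (j + x) %% l)).
Proof.
move=> jl; have l0 : 0 < l by lia.
split=> [[h1 h2 h3]|h]; last first.
  split=> [x y xn yl xy|x y xn yl xy|x xl].
  - by rewrite h // (addnC j) xy modn_small.
  - by rewrite h // (addnC j) xy modnDr modn_small.
  - by rewrite !h ?addnA ?modnDr //; lia.
elim/ltn_ind=> x IH xn.
have [xjl|lxj] := ltnP (j + x) l; first by rewrite modn_small // (h1 x (j + x)) // addnC.
have [xl|lx] := ltnP x l.
  have E : (j + x) %% l = j + x - l.
    by rewrite -[in LHS](subnK lxj) modnDr modn_small //; lia.
  by rewrite (h2 x (j + x - l)) ?E //; lia.
have := h3 (x - l); rewrite subnK // => <- //.
rewrite IH; [|lia|lia].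
by rewrite -[in RHS](subnK lx) addnA modnDr.
Qed.

Definition cycle_in_word n i l : Prop :=
  [/\ 0 < l, l <= n & forall j, j < l -> exists a, cycle_at n i l j a].

(** Quantifying over words is not available, so sets of windows are compared
through the positions at which their elements occur in [s]. *)
Definition same_cycle n i l i' l' : Prop := forall a,
  (exists j, j < l /\ cycle_at n i l j a) <-> (exists j, j < l' /\ cycle_at n i' l' j a).

(** A chain of quantifiers over numbers instead of one quantifier over lists, so
that each [c] gives a formula. *)
Fixpoint more_classes c n (xs : seq (nat * nat)) : Prop :=
  if c is c'.+1 then
    exists i l, [/\ cycle_in_word n i l,
      foldr (fun y P => ~ same_cycle n i l y.1 y.2 /\ P) True xs
      & more_classes c' n ((i, l) :: xs)]
  else True.

(** The classes of these words are those counted for [n.+1] and not for [n]; see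
[new_blockP]. *)
Definition new_block n a l : Prop := [/\ a + l = n.+1, 0 < l,
  forall b, b < a -> ~ (forall x, x < l -> s (b + x) = s (a + x))
  & forall j, j < l -> exists b, b + l <= n.+1 /\ cycle_at l a l j b].

Definition new_class n : Prop := exists a l, new_block n a l.

Section Definability.
Variable k : nat.
Hypotheses (hk : 2 <= k) (hs : automatic k s).

Lemma definable_and3 (P Q R : (nat -> nat) -> Prop) :
  definable k P -> definable k Q -> definable k R ->
  definable k (fun e => [/\ P e, Q e & R e]).
Proof.
move=> dP dQ dR; apply: (recog_ext (f := fun e => P e /\ Q e /\ R e)) => [e|].
  by apply/propext; split=> [[? []]|[]].
by apply: definable_and => //; apply: definable_and.
Qed.

Lemma definable_and4 (P Q R S : (nat -> nat) -> Prop) :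
  definable k P -> definable k Q -> definable k R -> definable k S ->
  definable k (fun e => [/\ P e, Q e, R e & S e]).
Proof.
move=> dP dQ dR dS; apply: (recog_ext (f := fun e => P e /\ [/\ Q e, R e & S e])) => [e|].
  by apply/propext; split=> [[? []]|[]].
by apply: definable_and => //; apply: definable_and3.
Qed.

Ltac definability := repeat (cbv beta; first
  [ exact: definable_term_var | exact: definable_term0 | apply: definable_termS
  | apply: definable_term_add | apply: definable_and3 | apply: definable_and4 | apply: definable_and
  | apply: definable_or | apply: definable_iff | apply: definable_not
  | apply: definable_lt | apply: definable_leq | apply: definable_eq
  | apply: (definable_eq_seq hk (recog_automatic hk hs))
  | apply: (@definable_ex k hk) | apply: (@definable_all k hk) | apply: definable_imp
  | exact: hk ]).

Lemma definable_cycle_at n i l j a :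
  definable k (fun e => cycle_at (e n) (e i) (e l) (e j) (e a)).
Proof. by rewrite /cycle_at; definability. Qed.

Lemma definable_cycle_in_word n i l :
  definable k (fun e => cycle_in_word (e n) (e i) (e l)).
Proof.
rewrite /cycle_in_word; apply: definable_and3; [by definability..|].
apply: definable_all => //; apply: definable_imp; first by definability.
apply: definable_ex => //; exact: definable_cycle_at.
Qed.

Lemma definable_same_cycle n i l i' l' :
  definable k (fun e => same_cycle (e n) (e i) (e l) (e i') (e l')).
Proof.
rewrite /same_cycle; apply: definable_all => //.
by apply: definable_iff; apply: definable_ex => //; apply: definable_and;
  [by definability|exact: definable_cycle_at|by definability|exact: definable_cycle_at].
Qed.

Lemma definable_new_class n : definable k (fun e => new_class (e n)).
Proof.
rewrite /new_class /new_block; apply: definable_ex => //; apply: definable_ex => //.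
apply: definable_and4; [by definability..|].
apply: definable_all => //; apply: definable_imp; first by definability.
apply: definable_ex => //; apply: definable_and; first by definability.
exact: definable_cycle_at.
Qed.

(** The list of words chosen so far is given by the indices of the variables that
hold them; each quantifier pair shifts these indices by two. *)
Lemma definable_more_classes c n (xs : seq (nat * nat)) :
  definable k (fun e => more_classes c (e n) [seq (e p.1, e p.2) | p <- xs]).
Proof.
elim: c n xs => [|c IH] n xs /=; first exact: recog_cst.
apply: definable_ex => //; apply: definable_ex => //; apply: definable_and3.
- exact: definable_cycle_in_word.
- elim: xs => [|x xs IHxs] /=; first exact: recog_cst.
  apply: definable_and => //.
  by apply: definable_not; apply: definable_same_cycle.
- apply: recog_ext (IH n.+2 ((1, 0) :: [seq (p.1.+2, p.2.+2) | p <- xs])) => e /=.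
  by rewrite -map_comp.
Qed.

End Definability.
End Formulas.

(** * Conjugacy classes as sets of windows of periodic words *)

Section Cyclic.
Variables (A : finType) (a0 : A).
Implicit Types (p u v : seq A) (w : nat -> A).

Definition cyc p : nat -> A := fun x => nth a0 p (x %% size p).

Lemma cyc_periodic p : periodic (cyc p) (size p).
Proof. by move=> x; rewrite /cyc modnDr. Qed.

Lemma size_gt0 p : p <> [::] -> 0 < size p.
Proof. by case: p. Qed.

Lemma mkseq_cyc p : mkseq (cyc p) (size p) = p.
Proof.
apply: (@eq_from_nth _ a0) => [|i]; rewrite size_mkseq // => ip.
by rewrite nth_mkseq // /cyc modn_small.
Qed.

Lemma cyc_mkseq f l : 0 < l -> periodic f l -> cyc (mkseq f l) = f.
Proof.
move=> l0 fl; apply/funext => x; rewrite /cyc size_mkseq nth_mkseq ?ltn_pmod //.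
by rewrite [in RHS](divn_eq x l) addnC periodic_mul.
Qed.

Lemma size_word_pow v j : size (word_pow v j) = j * size v.
Proof. by elim: j => //= j IH; rewrite size_cat -/(word_pow v j) IH mulSn. Qed.

Lemma nth_word_pow v j x : x < j * size v -> nth a0 (word_pow v j) x = cyc v x.
Proof.
elim: j x => // j IH x; rewrite mulSn => hx /=; rewrite nth_cat -/(word_pow v j).
case: ltnP => xv; first by rewrite /cyc modn_small.
rewrite IH; last by lia.
by rewrite -[in RHS](subnK xv) cyc_periodic.
Qed.

Lemma cyc_word_pow v j : 0 < j -> cyc (word_pow v j) = cyc v.
Proof.
move=> j0; apply/funext => x; have [v0|v0] := posnP (size v).
  by rewrite /cyc !nth_default // ?size_word_pow v0 ?muln0.
rewrite {1}/cyc size_word_pow nth_word_pow ?ltn_pmod ?muln_gt0 ?j0 //.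
by rewrite /cyc modn_dvdm // dvdn_mull.
Qed.

Lemma frac_pow_cyc v n : v <> [::] -> frac_pow v n = mkseq (cyc v) n.
Proof.
move=> /size_gt0 v0; have le : n <= n * size v by rewrite leq_pmulr.
apply: (@eq_from_nth _ a0); rewrite size_takel ?size_word_pow ?size_mkseq // => i hi.
by rewrite nth_take // nth_mkseq // nth_word_pow // (leq_trans hi).
Qed.

Lemma rot_cyc p j : p <> [::] -> j <= size p ->
  rot j p = mkseq (fun x => cyc p (j + x)) (size p).
Proof.
move=> /size_gt0 p0 jp.
apply: (@eq_from_nth _ a0); rewrite size_rot ?size_mkseq // => i hi.
rewrite nth_mkseq // /rot nth_cat size_drop /cyc; case: ltnP => h.
  by rewrite nth_drop modn_small //; lia.
rewrite nth_take; last lia.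
have -> : j + i = i - (size p - j) + size p by lia.
by rewrite modnDr modn_small //; lia.
Qed.

Lemma cyc_rot p j : p <> [::] -> j <= size p -> cyc (rot j p) = (fun x => cyc p (j + x)).
Proof.
move=> p0 jp; rewrite rot_cyc // cyc_mkseq ?size_gt0 //.
exact: periodic_shift (cyc_periodic p).
Qed.

Lemma conj_class_rot p v : conj_class p v <-> exists2 j, j <= size p & v = rot j p.
Proof.
split=> [[x [y [-> ->]]]|[j jp ->]]; last first.
  by exists (take j p), (drop j p); rewrite cat_take_drop.
by exists (size x); rewrite ?rot_size_cat // size_cat leq_addr.
Qed.

Lemma conj_class_at_windows p n : p <> [::] -> conj_class_at p n = windows n (cyc p).
Proof.
move=> p0; have l0 := size_gt0 p0.
have nil j : rot j p <> [::] by move/(congr1 size); rewrite size_rot /=; lia.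
apply/seteqP; split=> [_ [_ /conj_class_rot[j jp ->] <-]|_ [i _ <-]].
  exists j => //; rewrite frac_pow_cyc //; apply: eq_mkseq => x.
  by rewrite cyc_rot.
have il : i %% size p <= size p by apply: ltnW; rewrite ltn_pmod.
exists (rot (i %% size p) p); first by apply/conj_class_rot; exists (i %% size p).
rewrite frac_pow_cyc //; apply: eq_mkseq => x; rewrite cyc_rot //.
by rewrite /cyc modnDml.
Qed.

(** A power has the same periodic word as its base, so descend to a base that is
not a power of another word. *)
Lemma primitive_root p : p <> [::] ->
  exists v, [/\ primitive v, size v <= size p & cyc v = cyc p].
Proof.
have [m] := ubnP (size p); elim: m p => // m IH p pm p0.
have [|np] := pselect (primitive p); first by exists p.
have [v [j [vp E]]] : exists v j, v <> p /\ p = word_pow v j.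
  by apply: contrapT => none; apply: np.
have j0 : 0 < j by case: j E => // E; case: p0.
have v0 : v <> [::].
  by move=> v0; apply: p0; apply: size0nil; rewrite E size_word_pow v0 muln0.
have sv := size_gt0 v0.
have lt : size v < size p.
  rewrite E size_word_pow; case: j E j0 => [//|[|j]] E _; last by rewrite !mulSn; lia.
  by case: vp; rewrite E /word_pow /= cats0.
have [|u [pu su cu]] := IH v _ v0; first by lia.
exists u; split=> //; first by lia.
by rewrite cu E cyc_word_pow.
Qed.

Lemma FacP w n f : Fac w (mkseq f n) <-> exists j, forall x, x < n -> f x = w (j + x).
Proof.
split=> [[j E]|[j E]]; exists j; last first.
  apply: (@eq_from_nth _ a0) => [|i]; rewrite !size_mkseq // => hi.
  by rewrite !nth_mkseq // E.
move=> x hx; have := congr1 (nth a0 ^~ x) E.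
by rewrite size_mkseq !nth_mkseq.
Qed.

(** From a periodic word one gets a primitive [p] by taking the root of a period;
that [p] itself occurs in [w] follows because it is a prefix of a window. *)
Lemma eL_classesE w n : eL_classes w n = [set windows n f | f in cyclic_in w n].
Proof.
apply/seteqP; split=> [C [p [-> sub pn [_ pr]]]|_ [f [[l [/andP[l0 ln] fl]] win] <-]].
  have p0 := pr.1; rewrite conj_class_at_windows // in sub *.
  exists (cyc p) => //; split.
    by exists (size p); split; [rewrite size_gt0|exact: cyc_periodic].
  by move=> i; apply/FacP; apply: sub; exists i.
pose p := mkseq f l.
have p0 : p <> [::] by move/(congr1 size); rewrite size_mkseq /=; lia.
have [v [pv sv cv]] := primitive_root p0.
have vn : size v <= n by rewrite size_mkseq in sv; exact: leq_trans ln.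
rewrite cyc_mkseq // in cv; have v0 := pv.1.
exists v; split=> //.
- by rewrite conj_class_at_windows // cv.
- by move=> _ [i _ <-]; apply/FacP; apply: win.
- split=> //; have [j E] := win 0; rewrite -(mkseq_cyc v) cv; apply/FacP.
  by exists j => x hx; rewrite -E ?add0n //; lia.
Qed.

End Cyclic.

(** * Extended Lie complexity *)

Section ExtendedLie.
Variables (A : finType) (s : nat -> A).

Definition cycle_of (y : nat * nat) : nat -> A := fun x => s (y.1 + x %% y.2).

Lemma cycle_of_periodic y : periodic (cycle_of y) y.2.
Proof. by move=> x; rewrite /cycle_of modnDr. Qed.

Lemma windows_cycle_at n i l a : 0 < l ->
  windows n (cycle_of (i, l)) (mkseq (fun x => s (a + x)) n) <->
  exists j, j < l /\ cycle_at s n i l j a.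
Proof.
move=> l0; split=> [[j _ E]|[j [jl /(cycle_atP s n i a jl) H]]].
  exists (j %% l); have jl : j %% l < l by rewrite ltn_pmod.
  split=> //; apply/(cycle_atP s n i a jl) => x xn.
  have := congr1 (nth (s 0) ^~ x) E; rewrite !nth_mkseq // => <-.
  by rewrite /cycle_of /= modnDml.
exists j => //; apply: (@eq_from_nth _ (s 0)); rewrite !size_mkseq // => x xn.
by rewrite !nth_mkseq // H.
Qed.

Lemma cycle_in_wordP n i l :
  cycle_in_word s n i l <-> 0 < l <= n /\ cyclic_in s n (cycle_of (i, l)).
Proof.
split=> [[l0 ln H]|[/andP[l0 ln] [_ H]]].
  split; first by rewrite l0.
  split; first by exists l; rewrite l0; split=> //; apply: cycle_of_periodic.
  move=> j; have jl : j %% l < l by rewrite ltn_pmod.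
  have [a /(cycle_atP s n i a jl) E] := H _ jl.
  by exists a => x /E ->; rewrite /cycle_of /= modnDml.
split=> // j jl; have [a E] := H j; exists a; apply/(cycle_atP s n i a jl) => x xn.
by rewrite -E.
Qed.

(** The period of the word is at most [n], so its first window, which occurs in
[s], contains a full period. *)
Lemma cyclic_in_cycle n f : cyclic_in s n f ->
  exists y, cycle_in_word s n y.1 y.2 /\ cycle_of y = f.
Proof.
move=> cf; have [[l [hl fl]] win] := cf; have [i E] := win 0.
suff fE : cycle_of (i, l) = f.
  by exists (i, l); split=> //=; apply/cycle_in_wordP; rewrite fE.
apply/funext => x; rewrite /cycle_of /=.
have -> : f x = f (x %% l) by rewrite [in LHS](divn_eq x l) addnC periodic_mul.
case/andP: hl => l0 ln; rewrite -E ?add0n //.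
by apply: leq_trans ln; rewrite ltn_pmod.
Qed.

Lemma same_cycleP n y z : cycle_in_word s n y.1 y.2 -> cycle_in_word s n z.1 z.2 ->
  same_cycle s n y.1 y.2 z.1 z.2 <-> windows n (cycle_of y) = windows n (cycle_of z).
Proof.
case: y z => [i l] [i' l'] /= vy vz; have [l0 _ _] := vy; have [l'0 _ _] := vz.
split=> [H|E a]; last by rewrite -!windows_cycle_at // E.
have /cycle_in_wordP[_ [_ wy]] := vy; have /cycle_in_wordP[_ [_ wz]] := vz.
apply/seteqP; split=> u uw.
  have [j _ uE] := uw; have [a Ea] := wy j.
  have {uE} uE : u = mkseq (fun x => s (a + x)) n.
    by rewrite -uE; apply/eq_in_map => x; rewrite mem_iota => /andP[_ /Ea].
  by rewrite uE in uw *; apply/windows_cycle_at => //; apply/H/windows_cycle_at.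
have [j _ uE] := uw; have [a Ea] := wz j.
have {uE} uE : u = mkseq (fun x => s (a + x)) n.
  by rewrite -uE; apply/eq_in_map => x; rewrite mem_iota => /andP[_ /Ea].
by rewrite uE in uw *; apply/windows_cycle_at => //; apply/H/windows_cycle_at.
Qed.

(** A greedy choice: as long as fewer words are listed than there are classes, some
class is not listed. *)
Lemma more_classesP n c (xs : seq (nat * nat)) :
  (forall y, y \in xs -> cycle_in_word s n y.1 y.2) ->
  uniq [seq windows n (cycle_of y) | y <- xs] ->
  more_classes s c n xs <-> c + size xs <= #|` fset_set (eL_classes s n)|%fset.
Proof.
set E := eL_classes s n; have finE : finite_set E := finite_eL_classes s n.
have inE y : cycle_in_word s n y.1 y.2 -> windows n (cycle_of y) \in fset_set E.
  case: y => i l /cycle_in_wordP[_ cy]; rewrite in_fset_set //; apply/mem_set.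
  by rewrite /E (eL_classesE (s 0)); exists (cycle_of (i, l)).
have fresh y (zs : seq (nat * nat)) : cycle_in_word s n y.1 y.2 ->
    (forall z, z \in zs -> cycle_in_word s n z.1 z.2) ->
    foldr (fun z P => ~ same_cycle s n y.1 y.2 z.1 z.2 /\ P) True zs <->
    windows n (cycle_of y) \notin [seq windows n (cycle_of z) | z <- zs].
  move=> vy; elim: zs => [|z zs IH] vzs //=.
  have vz := vzs z (mem_head _ _).
  have {}IH := IH (fun t tz => vzs t (mem_behead (s := z :: zs) tz)).
  rewrite in_cons negb_or; split=> [[ns /IH ->]|/andP[/eqP neq /IH nzs]].
    by rewrite andbT; apply/eqP => eqw; apply/ns/same_cycleP.
  by split=> // /same_cycleP-/(_ vy vz).
elim: c xs => [|c IH] xs vxs uxs /=.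
  split=> // _; rewrite add0n -(size_map (fun y => windows n (cycle_of y))).
  by apply: uniq_leq_size => // _ /mapP[y /vxs vy ->]; apply: inE.
split=> [[i [l [vy /(fresh (i, l)) fy mor]]]|lt].
  rewrite addSnnS; apply/(IH ((i, l) :: xs)) => //=.
    by move=> y; rewrite in_cons => /orP[/eqP-> //|/vxs].
  by rewrite uxs andbT; apply: fy.
have [C CE Cxs] : exists2 C,
    C \in fset_set E & C \notin [seq windows n (cycle_of y) | y <- xs].
  apply: contrapT => none.
  have : #|` fset_set E|%fset <= size xs.
    rewrite -(size_map (fun y => windows n (cycle_of y))).
    apply: uniq_leq_size => // C CE; apply: contrapT => /negP Cxs.
    by apply: none; exists C.
  by rewrite leqNgt (leq_trans _ lt) // addSn ltnS leq_addl.
move: CE; rewrite in_fset_set // => /set_mem; rewrite /E (eL_classesE (s 0)).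
move=> [f /cyclic_in_cycle[[i l] [/= vy <-]] EC]; rewrite -EC in Cxs.
exists i, l; split=> //; first exact/(fresh (i, l)).
apply/IH => /=.
- by move=> y; rewrite in_cons => /orP[/eqP-> //|/vxs].
- by rewrite Cxs.
- by rewrite addnS -addSn.
Qed.

Lemma eL_classes_le (k : nat) : 2 <= k -> automatic k s ->
  exists B, forall n, #|` fset_set (eL_classes s n)|%fset <= B.
Proof.
move=> hk hs; have [C HC] := windows_code hk hs; exists #|C| => n.
have finE := finite_eL_classes s n.
case: n finE => [|n] finE.
  have -> : eL_classes s 0 = set0.
    rewrite (eL_classesE (s 0)); apply/seteqP; split=> // W [f [[l [hl _]] _] _].
    by move: hl; lia.
  by rewrite fset_set0 cardfs0.
have [code inj] := HC n.+1 isT.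
have rep (W : set (seq A)) : exists f, W \in fset_set (eL_classes s n.+1) ->
    cyclic_in s n.+1 f /\ windows n.+1 f = W.
  have [|nin] := boolP (W \in fset_set (eL_classes s n.+1)); last by exists s.
  rewrite in_fset_set // => /set_mem; rewrite (eL_classesE (s 0)) => -[f cf <-].
  by exists f.
have [f Hf] := choice rep.
rewrite cardE -(size_map (code \o f)); apply: uniq_leq_size; last first.
  by move=> c _; rewrite mem_enum.
rewrite map_inj_in_uniq ?fset_uniq // => W W' inW inW' /= eqc.
have [cW <-] := Hf W inW; have [cW' <-] := Hf W' inW'.
exact: inj.
Qed.

(** A count bounded by [B] is the number of [c < B] for which it exceeds [c]. The
value at [0] is prescribed separately. *)
Theorem eL_automatic (k : nat) : 2 <= k -> automatic k s -> automatic k (eL s).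
Proof.
move=> hk hs; have [B HB] := eL_classes_le hk hs; apply: automatic_recog.
pose h (b : Prop) (l : seq Prop) := if `[<b>] then 1 else count (fun P => `[<P>]) l.
apply: (recog_ext (f := fun e => h (e 0 = 0)
    [seq more_classes s c.+1 (e 0) [::] | c <- iota 0 B])).
  move=> e; rewrite /h /eL; case: asboolP => [->|/eqP/negPf ->] //.
  move: (HB (e 0)); set N := #|` _|%fset => NB.
  have -> : [seq more_classes s c.+1 (e 0) [::] | c <- iota 0 B] =
            [seq is_true (c < N) | c <- iota 0 B].
    by apply: eq_map => c; apply/propext; rewrite (@more_classesP _ _ [::]) // addn0.
  rewrite count_map -(subnKC NB) iotaD count_cat.
  rewrite (eq_in_count (a2 := xpredT)) => [|c]; last first.
    by rewrite mem_iota add0n => /andP[_ cN]; apply/asboolP.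
  rewrite count_predT size_iota (@eq_in_count _ _ pred0) => [|c]; last first.
    rewrite mem_iota add0n => /andP[Nc _]; apply/negbTE/negP => /asboolP.
    by rewrite ltnNge Nc.
  by rewrite count_pred0 addn0.
apply: recog_comp2.
  by apply: definable_eq => //; [exact: definable_term_var|exact: definable_term0].
apply: recog_seq => c; exact: (definable_more_classes hk hs c.+1 0 [::]).
Qed.

End ExtendedLie.

(** * Prefix Lie complexity *)

Section PrefixLie.
Variables (A : finType) (s : nat -> A).

Definition block a l : seq A := mkseq (fun x => s (a + x)) l.

Lemma eq_block f a l : (forall x, x < l -> f x = s (a + x)) -> mkseq f l = block a l.
Proof. by move=> E; apply/eq_in_map => x; rewrite mem_iota => /andP[_ /E]. Qed.

Lemma eq_mkseqP (f g : nat -> A) l :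
  mkseq f l = mkseq g l -> forall x, x < l -> f x = g x.
Proof. by move=> E x xl; have := congr1 (nth (s 0) ^~ x) E; rewrite !nth_mkseq. Qed.

Lemma Fac_finP n v : Fac_fin (prefix_of s n) v <->
  exists b, b + size v <= n /\ v = block b (size v).
Proof.
rewrite /prefix_of /block; split=> [/infixP[p [t E]]|[b [le E]]].
  have sz : n = size p + (size v + size t).
    by rewrite -!size_cat -E size_mkseq.
  exists (size p); split; first by rewrite sz leq_add2l leq_addr.
  apply: (@eq_from_nth _ (s 0)); first by rewrite size_mkseq.
  move=> i iv; rewrite nth_mkseq //.
  have := congr1 (nth (s 0) ^~ (size p + i)) E.
  rewrite nth_mkseq; last by rewrite sz ltn_add2l ltn_addr.
  by rewrite nth_cat ltnNge leq_addr /= addKn nth_cat iv => <-.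
apply/infixP.
exists (mkseq s b), (mkseq (fun x => s (b + size v + x)) (n - (b + size v))).
apply: (@eq_from_nth _ (s 0)) => [|i]; rewrite ?size_cat !size_mkseq; first by lia.
move=> hi; rewrite nth_mkseq // nth_cat size_mkseq; case: ltnP => ib.
  by rewrite nth_mkseq.
rewrite nth_cat; case: ltnP => iv; last by rewrite nth_mkseq; [congr s|]; lia.
by rewrite {1}E nth_mkseq // subnKC.
Qed.

Lemma conj_class_refl (p : seq A) : conj_class p p.
Proof. by apply/conj_class_rot; exists 0; rewrite ?rot0. Qed.

Lemma conj_class_sub (p v : seq A) : conj_class p v -> conj_class v `<=` conj_class p.
Proof.
move=> /conj_class_rot[j jp ->] u /conj_class_rot[i]; rewrite size_rot => ip ->.
apply/conj_class_rot; rewrite rot_add_mod //.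
case: leqP => h; [exists (i + j)|exists (i + j - size p)] => //; lia.
Qed.

Lemma conj_class_eq (p v : seq A) : conj_class p v -> conj_class v = conj_class p.
Proof.
move=> pv; apply/seteqP; split; first exact: conj_class_sub.
apply: conj_class_sub; have [x [y [-> ->]]] := pv.
by exists y, x.
Qed.

Lemma pL_classesP n p : pL_classes s n (conj_class p) <->
  forall v, conj_class p v -> Fac_fin (prefix_of s n) v.
Proof.
by split=> [[q [Eq sub]] v|sub]; [apply: sub|exists p].
Qed.

Lemma Fac_finS n v : Fac_fin (prefix_of s n) v -> Fac_fin (prefix_of s n.+1) v.
Proof. by move=> /Fac_finP[b [le E]]; apply/Fac_finP; exists b; split=> //; lia. Qed.

Lemma rot_block a l j : j < l ->
  rot j (block a l) = mkseq (fun x => s (a + (j + x) %% l)) l.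
Proof.
move=> jl; rewrite (rot_cyc (s 0)) ?size_mkseq //; last exact: ltnW.
  apply/eq_in_map => x; rewrite mem_iota => /andP[_ xl].
  by rewrite /cyc size_mkseq nth_mkseq // ltn_pmod //; lia.
by move/(congr1 size); rewrite size_mkseq /=; lia.
Qed.

Lemma rot_block_Fac n a l j : j < l ->
  Fac_fin (prefix_of s n) (rot j (block a l)) <->
  exists b, b + l <= n /\ cycle_at s l a l j b.
Proof.
move=> jl; rewrite rot_block //; split.
  move=> /Fac_finP[b]; rewrite size_mkseq => -[le E]; exists b; split=> //.
  by apply/(cycle_atP s l a b jl) => x xl; rewrite (eq_mkseqP E).
move=> [b [le /(cycle_atP s l a b jl) E]]; apply/Fac_finP; exists b.
by rewrite size_mkseq; split=> //; apply: eq_block => x xl; rewrite E.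
Qed.

(** Some word of a new class occurs in the longer prefix only, hence is a suffix of
it without earlier occurrence; the class of [p] is the class of this suffix. *)
Lemma new_blockP n C :
  pL_classes s n.+1 C /\ ~ pL_classes s n C <->
  exists a l, new_block s n a l /\ C = conj_class (block a l).
Proof.
split=> [[[p [-> sub]] nC]|[a [l [[al l0 fresh H] ->]]]].
  have [v [pv nv]] : exists v, conj_class p v /\ ~ Fac_fin (prefix_of s n) v.
    apply: contrapT => none; apply/nC/pL_classesP => v pv.
    by apply: contrapT => nv; apply: none; exists v.
  have /Fac_finP[a [le E]] := sub v pv.
  have al : a + size v = n.+1.
    apply/eqP; rewrite eqn_leq le /= ltnNge; apply/negP => le'.
    by apply/nv/Fac_finP; exists a.
  exists a, (size v); rewrite -E (conj_class_eq pv); split=> //; split=> //.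
  - rewrite lt0n; apply/eqP => v0; apply/nv/Fac_finP; exists 0.
    by rewrite (size0nil v0).
  - move=> b ba eqb; apply/nv/Fac_finP; exists b; split; first by lia.
    by rewrite E size_mkseq; apply: eq_block => x /eqb ->.
  - move=> j jv; apply/rot_block_Fac => //; apply: sub; rewrite -E.
    by rewrite -(conj_class_eq pv); apply/conj_class_rot; exists j => //; apply: ltnW.
split.
  apply/pL_classesP => v /conj_class_rot[j]; rewrite size_mkseq => jl ->.
  have [lt|ge] := ltnP j l; first exact/rot_block_Fac/H.
  rewrite rot_oversize ?size_mkseq // -(rot0 (block a l)).
  exact/rot_block_Fac/H.
move=> /pL_classesP/(_ _ (conj_class_refl _))/Fac_finP[b]; rewrite size_mkseq => -[le E].
by apply: (fresh b); [lia|move=> x xl; rewrite (eq_mkseqP E)].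
Qed.

(** The longer block starts with a letter [c], and its rotation by one letter
occurs in the prefix. The rotation ends in [c], so that the rest of the longer
block, and with it the shorter block, occurs before the end of the prefix. *)
Lemma new_block_inj n a l a' l' : new_block s n a l -> new_block s n a' l' -> ~ a < a'.
Proof.
move=> [al l0 _ H] [al' l'0 fresh _] lt.
have [|b [le E]] := H 1; first by lia.
have l1 : 1 < l by lia.
move/(cycle_atP s l a b l1): E => E.
apply: (fresh (b + (a' - a).-1)); first by lia.
move=> y yl; rewrite -addnA E; [|lia].
by rewrite modn_small; [congr s|]; lia.
Qed.

Lemma pLS n : pL s n.+1 = pL s n + (if `[<new_class s n>] then 1 else 0).
Proof.
have fin m := finite_pL_classes s m.
have mono : pL_classes s n `<=` pL_classes s n.+1.
  by move=> C [p [-> sub]]; exists p; split=> // v /sub /Fac_finS.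
rewrite /pL; case: asboolP => [[a [l new]]|none].
  have -> : pL_classes s n.+1 = conj_class (block a l) |` pL_classes s n.
    apply/seteqP; split=> C; last first.
      case=> [->|/mono //].
      by have [] := (new_blockP n (conj_class (block a l))).2; first by exists a, l.
    move=> CS; have [|nC] := pselect (pL_classes s n C); first by right.
    left; have [a' [l' [new' ->]]] := (new_blockP n C).1 (conj CS nC).
    have E : a' = a.
      have [lt|lt|//] := ltngtP a a'.
        by case: (new_block_inj new new' lt).
      by case: (new_block_inj new' new lt).
    by rewrite /= E; have [? _ _ _] := new; have [? _ _ _] := new'; do 2 f_equal; lia.
  rewrite fset_setU1 // cardfsU1 addnC in_fset_set //.
  suff -> : (conj_class (block a l) \notin pL_classes s n) by [].
  apply/negP => /set_mem; have [] := (new_blockP n (conj_class (block a l))).2 => //.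
  by exists a, l.
have -> : pL_classes s n.+1 = pL_classes s n; last by rewrite addn0.
apply/seteqP; split=> // C CS; apply: contrapT => nC; apply: none.
by have [a [l [new _]]] := (new_blockP n C).1 (conj CS nC); exists a, l.
Qed.

Lemma pL0 : pL s 0 = 1.
Proof.
rewrite /pL; suff -> : pL_classes s 0 = [set conj_class [::]].
  by rewrite fset_set1 cardfs1.
apply/seteqP; split=> [C [p [-> sub]]|_ ->].
  have /Fac_finP[b] := sub p (conj_class_refl p); rewrite leqn0 addn_eq0.
  by move=> [/andP[_ /eqP/size0nil ->]].
apply/pL_classesP => v /conj_class_rot[j _ ->].
by apply/Fac_finP; exists 0.
Qed.

Lemma dpLE n : dpL s n = (if `[<new_class s n>] then 1 else 0)%R.
Proof.
rewrite /dpL pLS; case: ifP => _; rewrite ?addn0 ?subrr //.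
by rewrite PoszD addrAC subrr add0r.
Qed.

Lemma pL_sum n : Posz (pL s n) = (1 + \sum_(m < n) dpL s m)%R.
Proof.
elim: n => [|n IH]; first by rewrite pL0 big_ord0.
by rewrite big_ord_recr addrA -IH /dpL addrC subrK.
Qed.

End PrefixLie.

Theorem theorem18 (k : nat) (hk : 2 <= k) (A : finType) (s : nat -> A)
    (hs : automatic k s) :
  [/\ automatic k (eL s), automatic k (dpL s)
    & regular k (fun n => Posz (pL s n))].
Proof.
have rd : recog k (fun e => dpL s (e 0)).
  apply: recog_ext (recog_comp (fun P : Prop => if `[<P>] then 1 else 0)%R
    (definable_new_class hk hs 0)) => e.
  by rewrite dpLE.
split; first exact: eL_automatic.
- exact: automatic_recog.
- have -> : (fun n => Posz (pL s n)) = (fun n => 1 + \sum_(m < n) dpL s m)%R.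
    by apply/funext => n; rewrite pL_sum.
  exact: regular_sum.
Qed.
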